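(* There exists a universal constant $C>0$ (independent of the dimensions $m,d$, of the family and its cardinality, and of $p$) such that for all positive integers $m,d$ and every nonempty finite family $\mathcal A$ of real $m\times d$ matrices, with $W,S,B,H,D$ the quantities associated with $\mathcal A$ as defined in the context, $$W\le C\bigl(H+B+\sqrt{DS}\bigr),$$ and consequently, for every real $p\ge 1$, $$W\le C\Bigl(\frac{S}{\sqrt p}+B+H+\sqrt p\,D\Bigr).$$
   Context: Let $\mathcal A$ be a nonempty finite family of real $m\times d$ matrices. No symmetry or diagonal restriction is imposed on the matrices. Let $g$ be a standard Gaussian vector in $\mathbb R^m$ and $h$ a standard Gaussian vector in $\mathbb R^d$, with $g$ and $h$ independent; subscripts on $\mathbb E$ indicate the vectors over which the expectation is taken. Write $\|\cdot\|_2$ for the Euclidean norm, $\|\cdot\|_{\mathrm{HS}}$ for the Hilbert--Schmidt (Frobenius) norm and $\|\cdot\|_{\mathrm{op}}$ for the operator norm (Euclidean to Euclidean). Define $$W=\mathbb E_g\sup_{A\in\mathcal A}\|A^Tg\|_2,\qquad S=\mathbb E_{g,h}\sup_{A\in\mathcal A}|g^TAh|,$$ $$B=\sup_{x\in\mathbb R^d,\ \|x\|_2\le1}\mathbb E_g\sup_{A\in\mathcal A}|g^TAx|,\qquad H=\sup_{A\in\mathcal A}\|A\|_{\mathrm{HS}},\qquad D=\sup_{A\in\mathcal A}\|A\|_{\mathrm{op}}.$$ *)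

(* Defs.v *)
From mathcomp Require Import all_boot all_order all_algebra.
From mathcomp Require Import all_classical all_reals all_analysis.

Set Implicit Arguments.
Unset Strict Implicit.
Unset Printing Implicit Defensive.

Import Order.TTheory GRing.Theory Num.Theory.
Import numFieldNormedType.Exports.

Local Open Scope classical_set_scope.
Local Open Scope ring_scope.

Section norms.
Context {R : realType}.

(* MathComp-Analysis equips matrices with the max-norm, so the Euclidean,
   Hilbert-Schmidt and operator norms are introduced here. *)
Definition l2norm n (x : 'cV[R]_n) : R := Num.sqrt (\sum_i x i 0 ^+ 2).

Definition hsnorm m d (A : 'M[R]_(m, d)) : R :=
  Num.sqrt (\sum_i \sum_j A i j ^+ 2).

Definition opnorm m d (A : 'M[R]_(m, d)) : R :=
  sup [set l2norm (A *m x) | x in [set x : 'cV[R]_d | l2norm x <= 1]].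

Definition bilin m d (A : 'M[R]_(m, d)) (y : 'cV[R]_m) (x : 'cV[R]_d) : R :=
  (y^T *m A *m x) 0 0.

(* Random vectors are tuple-valued, because n.-tuple R carries the Borel
   sigma-algebra of R^n in the library whereas 'cV[R]_n has none. *)
Definition colv n (t : n.-tuple R) : 'cV[R]_n := \col_i tnth t i.

End norms.

Section random_vectors.
Context {disp : measure_display} {T : measurableType disp} {R : realType}.
Variable P : probability T R.

(* Since B i may be setT, the product rule for subfamilies is included. *)
Definition mutually_independent n (X : 'I_n -> T -> R) : Prop :=
  forall B : 'I_n -> set R, (forall i, measurable (B i)) ->
    P (\bigcap_i (X i @^-1` B i)) = (\prod_i P (X i @^-1` B i))%E.

Definition independent_vectors m d
    (g : {RV P >-> m.-tuple R}) (h : {RV P >-> d.-tuple R}) : Prop :=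
  forall (E : set (m.-tuple R)) (F : set (d.-tuple R)),
    measurable E -> measurable F ->
    P (g @^-1` E `&` h @^-1` F) = (P (g @^-1` E) * P (h @^-1` F))%E.

Definition standard_gaussian n (g : {RV P >-> n.-tuple R}) : Prop :=
  mutually_independent (fun i w => tnth (g w) i) /\
  forall (i : 'I_n) (B : set R), measurable B ->
    P ((fun w => tnth (g w) i) @^-1` B) = normal_prob 0 1 B.

End random_vectors.

Section parameters.
Context {R : realType} {m d : nat} (AA : set 'M[R]_(m, d)).
Context {disp : measure_display} {T : measurableType disp}.
Variables (P : probability T R).
Variables (g : {RV P >-> m.-tuple R}) (h : {RV P >-> d.-tuple R}).

Definition Wparam : \bar R :=
  ('E_P[fun w => sup [set l2norm (A^T *m colv (g w)) | A in AA]%R])%E.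

Definition Sparam : \bar R :=
  ('E_P[fun w => sup [set `|bilin A (colv (g w)) (colv (h w))| | A in AA]%R])%E.

Definition Bparam : \bar R :=
  ereal_sup [set ('E_P[fun w => sup [set `|bilin A (colv (g w)) x| | A in AA]%R])%E
            | x in [set x : 'cV[R]_d | l2norm x <= 1]].

Definition Hparam : R := sup [set hsnorm A | A in AA].

Definition Dparam : R := sup [set opnorm A | A in AA].

End parameters.

(* Main.v *)
Require Import Defs.
From HB Require Import structures.
From mathcomp Require Import all_boot all_order all_algebra.
From mathcomp Require Import all_classical all_reals all_analysis.
From mathcomp Require Import measurable_realfun ring lra.

Import Order.TTheory GRing.Theory Num.Theory.
Import numFieldNormedType.Exports.

Local Open Scope classical_set_scope.
Local Open Scope ring_scope.

(** The number W is the expected supremum of the forms <g, A x> over all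
    matrices A of the family and all unit vectors x. The proof trades the
    supremum over x for an average over a Gaussian vector sigma h, by a change of
    density.

    Put N(t) = E_g sup_A |<g, A t>|, so that E N(h) = S and N <= B on the unit
    ball. By the Cameron-Martin formula the law of sigma h + x has a density with
    respect to the law of sigma h, and on a set of large probability this density
    costs only a factor exp(O(1 / sigma ^ 2)). If F(g, t) is a function that
    dominates |<g, A t>| for the t = sigma h +- x with h in a set of probability
    at least 1 / 4, then exp(lam |<g, A x>|) is at most a constant times
    exp(O(1 / sigma ^ 2)) E_h exp(lam F(g, sigma h)), and the right-hand side
    depends neither on A nor on x: it bounds the exponential of lam sup_A |A^T g|.
    After taking the expectation in g and exchanging it with E_h, the exponential
    moment of F(., t) is needed at each fixed t.

    With F(g, t) = sup_A |<g, A t>|, Gaussian concentration around the mean N(t)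
    would give this moment, but neither N(t) nor the variance sup_A |A t| ^ 2 is
    under control at t = sigma h. The point of the proof is that F may be
    truncated: the supremum defining F(g, t) keeps only the matrices A with
    |A t| <= K = 2 (D + 8 sigma H), and F(g, t) = 0 unless N(t) <= B + 4 sigma S.
    The lower bound uses a single pair (A, x) at a time, and for a single pair the
    truncation is harmless: E |A h| ^ 2 is of order H ^ 2 and E N(h) <= S, so
    Markov's inequality gives both conditions at sigma h +- x with probability
    bounded from below. This is how H enters in place of E sup_A |A h|.

    Choosing lam = 1 / (sigma K) yields, for 0 < sigma <= 1,
    W <= B + 4 sigma S + 30 D / sigma + 240 H (supnorm_bound), and
    sigma = min (1, sqrt (D / S)) gives the first inequality (width_bound). The
    second one follows by the arithmetic-geometric mean inequality (sqrte_AMGM).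

    The concentration inequality for a maximum of finitely many Gaussian linear
    forms (maxdot_concentration) is proved by interpolating between two
    independent copies t and u of the Gaussian vector along the rotation of the
    plane (t, u). Rotation invariance lets the angle be halved at the price of
    doubling the exponent (Psi_double), and for a small angle a subgradient
    replaces the maximum by one linear form (Psi_step). *)

(** * The Gaussian measure on the line *)

Section density.
Local Open Scope ereal_scope.
Context d (T : measurableType d) (R : realType).
Variables (mu nu : {measure set T -> \bar R}) (phi : T -> R).
Hypothesis mphi : measurable_fun setT phi.
Hypothesis phi0 : forall x, (0 <= phi x)%R.
Hypothesis nuE : forall A, measurable A -> nu A = \int[mu]_(x in A) (phi x)%:E.

Import HBNNSimple.

Lemma ge0_integral_density (f : T -> \bar R) :
  measurable_fun [set: T] f -> (forall x, 0 <= f x) ->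
  \int[nu]_x f x = \int[mu]_x (f x * (phi x)%:E).
Proof.
move=> mf f0.
pose f_ := nnsfun_approx measurableT mf.
have nd x m n : (m <= n)%N -> (f_ m x <= f_ n x)%R.
  by move=> mn; exact/lefP/nd_nnsfun_approx.
have f_cvg x : EFin \o f_^~ x @ \oo --> f x by exact: cvg_nnsfun_approx.
transitivity (limn (fun n => \int[nu]_x (f_ n x)%:E)).
  rewrite -monotone_convergence//=.
  - by apply: eq_integral => x _; apply/esym/cvg_lim => //; exact: f_cvg.
  - by move=> n; exact/measurable_EFinP.
  - by move=> n x _; rewrite lee_fin.
  - by move=> x _ m n mn; rewrite lee_fin nd.
transitivity (limn (fun n => \int[mu]_x ((f_ n x)%:E * (phi x)%:E))); last first.
  rewrite -monotone_convergence//=.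
  - apply: eq_integral => x _; apply/cvg_lim => //.
    by apply: cvgeZr => //; exact: f_cvg.
  - by move=> n; apply/measurable_EFinP/measurable_funM.
  - by move=> n x _; rewrite -EFinM lee_fin mulr_ge0.
  - by move=> x _ m n mn; rewrite -!EFinM lee_fin ler_wpM2r// nd.
congr (limn _); apply/funext => n.
under eq_integral do rewrite fimfunE -fsumEFin//.
rewrite ge0_integral_fsum//; last 2 first.
- by move=> r; exact/measurable_EFinP/measurable_funM.
- by move=> r x _; rewrite nnfun_muleindic_ge0.
transitivity (\int[mu]_x (\sum_(r \in range (f_ n))
    ((r * \1_(f_ n @^-1` [set r]) x)%:E * (phi x)%:E))); last first.
  apply: eq_integral => x _; rewrite fimfunE -fsumEFin// ge0_mule_fsuml//.
  by move=> r; rewrite EFinM nnfun_muleindic_ge0.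
rewrite [RHS]ge0_integral_fsum//; last 2 first.
- move=> r; apply: emeasurable_funM; last exact/measurable_EFinP.
  exact/measurable_EFinP/measurable_funM.
- by move=> r x _; rewrite mule_ge0 ?lee_fin// -lee_fin EFinM nnfun_muleindic_ge0.
apply: eq_fsbigr => r _; rewrite integralZl_indic_nnsfun//.
rewrite integral_indic// setIT nuE//.
have [r0|r0] := leP 0%R r; last first.
  rewrite preimage_nnfun0// integral_set0 mule0 integral0_eq// => x _.
  by rewrite indicE in_set0 mulr0 mul0e.
set A := f_ n @^-1` [set r]; have mA : measurable A by exact: measurable_sfunP.
have -> : \int[mu]_(x in A) (phi x)%:E = \int[mu]_x (\1_A x * phi x)%:E.
  rewrite integral_mkcond; apply: eq_integral => x _.
  by rewrite patchE indicE; case: ifP; rewrite ?mul1r ?mul0r.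
rewrite -ge0_integralZl//.
- by apply: eq_integral => x _; rewrite !EFinM muleA.
- by apply/measurable_EFinP/measurable_funM => //; exact: measurable_indic.
- by move=> x _; rewrite lee_fin mulr_ge0.
Qed.

End density.

Section affine.
Local Open Scope ereal_scope.
Context {R : realType}.
Implicit Types (f : R -> \bar R) (a b : R).
Notation mu := (@lebesgue_measure R).

Lemma ge0_integral_oppr f : measurable_fun [set: R] f -> (forall x, 0 <= f x) ->
  \int[mu]_x f (- x)%R = \int[mu]_x f x.
Proof.
move=> mf f0.
have mN : measurable_fun [set: R] (-%R : R -> measurableTypeR R).
  exact: oppr_measurable.
transitivity (\int[pushforward mu (-%R : R -> measurableTypeR R)]_x f x).
  by rewrite ge0_integral_pushforward.
by apply: eq_measure_integral => A mA _; exact: lebesgue_measureN.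
Qed.

Lemma ge0_integral_affine_gt0 f a b : (0 < a)%R ->
  measurable_fun [set: R] f -> (forall x, 0 <= f x) ->
  a%:E * \int[mu]_x f (a * x + b)%R = \int[mu]_x f x.
Proof.
move=> a0 mf f0.
pose h : R -> measurableTypeR R := fun x => (a * x + b)%R.
have mh : measurable_fun [set: R] h.
  by apply: measurable_funD => //; exact: measurable_funM.
pose a' : {nonneg R} := NngNum (ltW a0).
pose nu := measure_function_pushforward__canonical__measure_function_Measure mu mh.
transitivity (\int[mscale a' nu]_x f x).
  by rewrite ge0_integral_mscale// ge0_integral_pushforward.
apply: eq_measure_integral => A mA _.
apply/esym/lebesgue_measure_unique => //= _ [[p q]] _ <- /=.
rewrite /mscale/= /pushforward.
have -> : h @^-1` `]p, q]%classic = `]((p - b) / a)%R, ((q - b) / a)%R]%classic.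
  apply/seteqP; split=> x /=; rewrite !in_itv/= /h ltr_pdivrMr// ler_pdivlMr//;
  by rewrite ltrBlDr lerBrDr [(x * a)%R]mulrC.
rewrite !lebesgue_measure_itv/= !lte_fin ltr_pM2r ?invr_gt0// ltrD2r.
case: ifP => _; last by rewrite mule0.
rewrite -!EFinB -EFinM; congr EFin; field; exact: lt0r_neq0.
Qed.

Lemma ge0_integral_affine f a b : a != 0%R ->
  measurable_fun [set: R] f -> (forall x, 0 <= f x) ->
  `|a|%:E * \int[mu]_x f (a * x + b)%R = \int[mu]_x f x.
Proof.
move=> a0 mf f0; have [a_gt0|a_le0] := ltP 0%R a.
  by rewrite gtr0_norm// ge0_integral_affine_gt0.
have Na_gt0 : (0 < - a)%R by rewrite oppr_gt0 lt_neqAle a0.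
rewrite ler0_norm// -[RHS](@ge0_integral_affine_gt0 f (- a) b)//.
rewrite -[in RHS]ge0_integral_oppr//.
- by congr (_ * _); apply: eq_integral => x _; rewrite mulrNN.
- by apply: measurableT_comp => //; exact: measurable_funD.
Qed.

End affine.

Section normal_line.
Local Open Scope ereal_scope.
Context {R : realType}.
Implicit Types (f : R -> \bar R) (y c s : R).
Notation gamma := (@normal_prob R 0 1).
Notation phi := (@normal_pdf R 0 1).

Lemma normal_pdf01E x : phi x = (normal_peak 1 * expR (- x ^+ 2 / 2))%R.
Proof.
by rewrite normal_pdfE ?oner_eq0//= /normal_fun subr0 expr1n.
Qed.

Lemma ge0_integral_normal f :
  measurable_fun [set: R] f -> (forall x, 0 <= f x) ->
  \int[gamma]_x f x = \int[lebesgue_measure]_x (f x * (phi x)%:E).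
Proof.
move=> mf f0; apply: ge0_integral_density => //.
- exact: measurable_normal_pdf.
- by move=> x; exact: normal_pdf_ge0.
Qed.

(** The standard normal measure shifted by y has density
    exp (y x - y ^ 2 / 2): complete the square. *)
Lemma cameron_martin1 y f :
  measurable_fun [set: R] f -> (forall x, 0 <= f x) ->
  \int[gamma]_x f x =
  \int[gamma]_x (f (x + y)%R * (expR (- (y * x) - y ^+ 2 / 2))%:E).
Proof.
move=> mf f0; rewrite !ge0_integral_normal//; last 2 first.
- apply: emeasurable_funM.
    by apply: (measurableT_comp mf); exact: measurable_funD.
  apply/measurable_EFinP/measurableT_comp => //; apply: measurable_funB => //.
  by apply: measurableT_comp => //; exact: measurable_funM.
- by move=> x; rewrite mule_ge0// lee_fin expR_ge0.
rewrite -(@ge0_integral_affine _ _ 1%R y)// ?oner_eq0//.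
- rewrite normr1 mul1e; apply: eq_integral => x _.
  rewrite mul1r -muleA; congr (_ * _); rewrite -EFinM !normal_pdf01E mulrCA -expRD.
  by congr (_ * expR _)%:E; field.
- apply: emeasurable_funM => //; apply/measurable_EFinP.
  exact: measurable_normal_pdf.
- by move=> x; rewrite mule_ge0// lee_fin normal_pdf_ge0.
Qed.

Lemma ge0_integral_normal2 (f : R * R -> \bar R) :
  measurable_fun [set: R * R] f -> (forall x, 0 <= f x) ->
  \int[gamma]_x \int[gamma]_y f (x, y) =
  \int[lebesgue_measure]_x \int[lebesgue_measure]_y
    (f (x, y) * (phi x * phi y)%:E).
Proof.
move=> mf f0.
have mphi : measurable_fun [set: R] phi by exact: measurable_normal_pdf.
have phi0 x : (0 <= phi x)%R by exact: normal_pdf_ge0.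
rewrite ge0_integral_normal; last 2 first.
- exact: (measurable_fun_fubini_tonelli_F (m2 := gamma)).
- by move=> x; exact: integral_ge0.
apply: eq_integral => x _; rewrite ge0_integral_normal//; last first.
  by apply: measurableT_comp => //; exact: measurable_pair1.
rewrite -ge0_integralZr//; last 3 first.
- apply: emeasurable_funM; last exact/measurable_EFinP.
  by apply: measurableT_comp => //; exact: measurable_pair1.
- by move=> y _; rewrite mule_ge0// lee_fin.
- by rewrite lee_fin.
by apply: eq_integral => y _; rewrite -muleA -EFinM [(phi x * _)%R]mulrC.
Qed.

(** The density of the product measure depends only on x ^ 2 + y ^ 2. The
    Lebesgue part of the rotation is split into two affine changes of one
    variable, which Tonelli's theorem allows when s <> 0: first y becomes
    u = c x + s y at fixed x, then x becomes v = (c u - x) / s at fixed u. *)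
Lemma rotation1 c s (f : R * R -> \bar R) : (c ^+ 2 + s ^+ 2)%R = 1%R -> (0 < s)%R ->
  measurable_fun [set: R * R] f -> (forall x, 0 <= f x) ->
  \int[gamma]_x \int[gamma]_y f ((c * x + s * y)%R, (c * y - s * x)%R) =
  \int[gamma]_x \int[gamma]_y f (x, y).
Proof.
move=> cs s0 mf f0.
have mphi : measurable_fun [set: R] phi by exact: measurable_normal_pdf.
have phi0 x : (0 <= phi x)%R by exact: normal_pdf_ge0.
have sN0 : (s != 0)%R by rewrite gt_eqF.
have phi_rot u v : (phi (c * u - s * v) * phi (s * u + c * v) = phi u * phi v)%R.
  rewrite !normal_pdf01E mulrACA [RHS]mulrACA -!expRD; congr (_ * expR _)%R.
  have -> : (u ^+ 2 = (c ^+ 2 + s ^+ 2) * u ^+ 2)%R by rewrite cs mul1r.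
  have -> : (v ^+ 2 = (c ^+ 2 + s ^+ 2) * v ^+ 2)%R by rewrite cs mul1r.
  by field.
have e1 (x u : R) : (c * x + s * (s^-1 * u + - (c * x) / s) = u)%R by field.
have e2 (x u : R) :
    (c * (s^-1 * u + - (c * x) / s) - s * x = (c * u - x) / s)%R.
  transitivity ((c * u - (c ^+ 2 + s ^+ 2) * x) / s)%R; first by field.
  by rewrite cs mul1r.
have e3 (x u : R) : (s^-1 * u + - (c * x) / s = (u - c * x) / s)%R by field.
have e4 (u v : R) : ((c * u - (- s * v + c * u)) / s = v)%R by field.
have e5 (u v : R) : (- s * v + c * u = c * u - s * v)%R by ring.
have e6 (u v : R) : ((u - c * (c * u - s * v)) / s = s * u + c * v)%R.
  transitivity (((c ^+ 2 + s ^+ 2) * u - c * (c * u - s * v)) / s)%R; last by field.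
  by rewrite cs mul1r.
pose k (z : R * R) := f (z.2, ((c * z.2 - z.1) / s)%R) *
  (phi z.1 * phi ((z.2 - c * z.1) / s) / s)%:E.
have k0 z : 0 <= k z by rewrite mule_ge0// lee_fin !mulr_ge0// invr_ge0 ltW.
have mk : measurable_fun [set: R * R] k.
  apply: emeasurable_funM.
    apply: measurableT_comp => //; apply: measurable_fun_pair => //=.
    apply: measurable_funM => //; apply: measurable_funB => //.
    exact: measurable_funM.
  apply/measurable_EFinP/measurable_funM => //; apply: measurable_funM.
    exact: measurableT_comp.
  apply: measurableT_comp => //; apply: measurable_funM => //.
  by apply: measurable_funB => //; exact: measurable_funM.
pose g (z : R * R) := f ((c * z.1 + s * z.2)%R, (c * z.2 - s * z.1)%R).
have g0 z : 0 <= g z by exact: f0.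
have mg : measurable_fun [set: R * R] g.
  apply: measurableT_comp => //; apply: measurable_fun_pair.
    by apply: measurable_funD; exact: measurable_funM.
  by apply: measurable_funB; exact: measurable_funM.
rewrite -[LHS]/(\int[gamma]_x \int[gamma]_y g (x, y)).
rewrite (ge0_integral_normal2 g mg g0) (ge0_integral_normal2 f mf f0).
transitivity (\int[lebesgue_measure]_x \int[lebesgue_measure]_u k (x, u)).
  apply: eq_integral => x _.
  rewrite -(@ge0_integral_affine _ _ s^-1%R (- (c * x) / s)%R) ?invr_eq0//; last 2 first.
  - apply: emeasurable_funM.
      by apply: measurableT_comp => //; exact: measurable_pair1.
    by apply/measurable_EFinP/measurable_funM.
  - by move=> y; rewrite mule_ge0// lee_fin mulr_ge0.
  rewrite -ge0_integralZl//; last 2 first.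
  - apply: emeasurable_funM => /=.
      apply: measurableT_comp => //=; apply: measurableT_comp => //.
      by apply: measurable_funD => //; exact: measurable_funM.
    apply/measurable_EFinP/measurable_funM => //; apply: measurableT_comp => //.
    by apply: measurable_funD => //; exact: measurable_funM.
  - by move=> y _; rewrite mule_ge0// lee_fin mulr_ge0.
  apply: eq_integral => u _; rewrite /k /g/= gtr0_norm ?invr_gt0//.
  by rewrite muleCA -EFinM e1 e2 e3 [X in _ * X%:E = _]mulrC.
transitivity (\int[lebesgue_measure]_u \int[lebesgue_measure]_x k (x, u)).
  exact: (@fubini_tonelli _ _ (measurableTypeR R) (measurableTypeR R) R
    lebesgue_measure lebesgue_measure).
apply: eq_integral => u _.
have mku : measurable_fun [set: R] (fun x => k (x, u)).
  by apply: measurableT_comp => //; exact: measurable_pair2.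
rewrite -(@ge0_integral_affine _ _ (- s)%R (c * u)%R) ?oppr_eq0//.
rewrite -ge0_integralZl//; last first.
  by apply: (measurableT_comp mku); exact: measurable_funD.
apply: eq_integral => v _; rewrite /k/= ltr0_norm ?oppr_lt0// opprK.
by rewrite muleCA -EFinM e4 e5 e6 [X in _ * X%:E = _]mulrC divfK// phi_rot.
Qed.
End normal_line.

(** * The Gaussian measure on tuples *)

Section gaussian_measure.
Context {R : realType}.
Notation gamma := (@normal_prob R 0 1).

Definition tcons {n} (z : measurableTypeR R * n.-tuple R) : n.+1.-tuple R := [tuple of z.1 :: z.2].

Lemma measurable_tcons n : measurable_fun [set: measurableTypeR R * n.-tuple R] (@tcons n).
Proof. exact: measurable_cons. Qed.

HB.instance Definition _ n := isMeasurableFun.Build _ _ _ _ (@tcons n) (measurable_tcons n).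

Fixpoint gaussian (n : nat) : probability (n.-tuple R) R :=
  match n with
  | 0 => \d_([tuple] : 0.-tuple R)
  | n'.+1 => distribution (gamma \x gaussian n')%E (@tcons n')
  end.

Local Open Scope ereal_scope.

Lemma integral_gaussian0 (f : 0.-tuple R -> \bar R) :
  measurable_fun [set: 0.-tuple R] f ->
  \int[gaussian 0]_t f t = f [tuple].
Proof. by move=> mf; rewrite integral_dirac// diracT mul1e. Qed.

Lemma integral_gaussianS n (f : n.+1.-tuple R -> \bar R) :
  measurable_fun [set: n.+1.-tuple R] f -> (forall t, 0 <= f t) ->
  \int[gaussian n.+1]_t f t =
  \int[gamma]_x \int[gaussian n]_t f (tcons (x, t)).
Proof.
move=> mf f0; rewrite [LHS]ge0_integral_distribution//.
rewrite fubini_tonelli1//=.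
exact: (measurableT_comp mf (measurable_tcons n)).
Qed.

Lemma measurable_box n (B : 'I_n -> set R) : (forall i, measurable (B i)) ->
  measurable [set t : n.-tuple R | forall i, B i (tnth t i)].
Proof.
move=> mB.
rewrite (_ : [set t | _] = \bigcap_(i in [set: 'I_n]) ((tnth (T := R))^~ i @^-1` B i)).
  apply: fin_bigcap_measurable => [|i _]; first exact: finite_finset.
  by have := @measurable_tnth _ R n i measurableT _ (mB i); rewrite setTI.
by apply/seteqP; split => t /= h i; [move=> _; exact: h|exact: h].
Qed.

Lemma gaussian_box n (B : 'I_n -> set R) : (forall i, measurable (B i)) ->
  gaussian n [set t | forall i, B i (tnth t i)] = \prod_(i < n) gamma (B i).
Proof.
elim: n B => [|n IH] B mB.
  by rewrite big_ord0/= diracE mem_set//= => -[].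
rewrite big_ord_recl/= -IH; last by move=> i; exact: mB.
rewrite -product_measure1E; [|exact: mB|]; last by apply: (measurable_box n (fun i => B (lift ord0 i))) => i; exact: mB.
rewrite /distribution/= /pushforward; congr (_ _); apply/seteqP; split => -[x t]/=.
  move=> h; split; first by have := h ord0; rewrite tnth0.
  by move=> i; have := h (lift ord0 i); rewrite tnthS.
move=> [hx ht] i; case: (unliftP ord0 i) => [j|] ->; last by rewrite tnth0.
by rewrite tnthS.
Qed.

(** The boxes form a pi-system that generates the sigma-algebra of tuples. *)
Lemma gaussian_unique n (nu : {measure set (n.-tuple R) -> \bar R}) :
  (forall B : 'I_n -> set R, (forall i, measurable (B i)) ->
    nu [set t | forall i, B i (tnth t i)] = \prod_(i < n) gamma (B i)) ->
  forall A, measurable A -> nu A = gaussian n A.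
Proof.
move=> nuE A mA.
pose G : set (set (n.-tuple R)) := [set X | exists2 B : 'I_n -> set R,
  (forall i, measurable (B i)) & X = [set t | forall i, B i (tnth t i)]].
have GT : G setT by exists (fun=> setT) => //; apply/seteqP; split.
apply/esym/(measure_unique G (fun=> setT)) => //.
- apply/seteqP; split.
    apply: smallest_sub; first exact: smallest_sigma_algebra.
    move=> X; rewrite -bigcup_seq/= => -[i _ [Y mY <-]].
    apply: sub_sigma_algebra; exists (fun j => if j == i then Y else setT).
      by move=> j; case: ifP.
    apply/seteqP; split => t /=.
      by move=> [_ Yt] j; case: ifP => // /eqP ->.
    by move=> /(_ i); rewrite eqxx.
  apply: smallest_sub; first exact: sigma_algebra_measurable.
  by move=> X [B mB ->]; exact: measurable_box.
- move=> X Y [B mB ->] [B' mB' ->]; exists (fun i => B i `&` B' i).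
    by move=> i; exact: measurableI.
  by apply/seteqP; split => t /=; [move=> [h h'] i; split|move=> h; split => i; case: (h i)].
- by rewrite bigcup_const.
- by move=> X [B mB ->]; rewrite nuE//; exact: gaussian_box.
- by move=> k; rewrite (le_lt_trans (probability_le1 _ _))// ltry.
Qed.

End gaussian_measure.

#[global] Opaque gaussian.

(** * Euclidean structure of tuples *)

Section tuples.
Context {R : realType} {n : nat}.
Implicit Types (a b : R) (t u v : n.-tuple R).

Definition tlin a b t u : n.-tuple R := [tuple a * tnth t i + b * tnth u i | i < n].

Definition tdot t u : R := \sum_(i < n) tnth t i * tnth u i.

Lemma tnth_tlin a b t u i : tnth (tlin a b t u) i = a * tnth t i + b * tnth u i.
Proof. by rewrite tnth_mktuple. Qed.

Lemma tdotC t u : tdot t u = tdot u t.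
Proof. by apply: eq_bigr => i _; rewrite mulrC. Qed.

Lemma tdot_linl a b t u v : tdot (tlin a b t u) v = a * tdot t v + b * tdot u v.
Proof.
rewrite /tdot !mulr_sumr -big_split/=; apply: eq_bigr => i _.
by rewrite tnth_tlin mulrDl !mulrA.
Qed.

Lemma tdot_scalel a t u : tdot (tlin a 0 t t) u = a * tdot t u.
Proof. by rewrite tdot_linl mul0r addr0. Qed.

Lemma tdot_ge0 t : 0 <= tdot t t.
Proof. by apply: sumr_ge0 => i _; rewrite -expr2 sqr_ge0. Qed.

Lemma tdot_eq0 t u : tdot t t = 0 -> tdot t u = 0.
Proof.
move=> /eqP; rewrite psumr_eq0; last by move=> i _; rewrite -expr2 sqr_ge0.
move=> /allP t0; rewrite /tdot big1// => i _.
have := t0 i; rewrite mem_index_enum => /(_ isT)/=.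
by rewrite mulf_eq0 orbb => /eqP ->; rewrite mul0r.
Qed.

(** Expand the square of (u . u) t - (t . u) u. *)
Lemma tdot_cauchy_schwarz t u : tdot t u ^+ 2 <= tdot t t * tdot u u.
Proof.
have [u0|uN0] := eqVneq (tdot u u) 0.
  by rewrite tdotC tdot_eq0// expr0n mulr_ge0 ?tdot_ge0.
have u0 : 0 < tdot u u by rewrite lt_neqAle eq_sym uN0 tdot_ge0.
have := tdot_ge0 (tlin (tdot u u) (- tdot t u) t u).
set v := tlin _ _ _ _; rewrite {1}/v tdot_linl ![tdot _ v]tdotC !tdot_linl (tdotC u t).
set a := tdot u u in u0 *; set b := tdot t u; set c := tdot t t => h.
rewrite -(ler_pM2l u0) -subr_ge0.
by have -> : a * (c * a) - a * b ^+ 2 = a * (a * c + - b * b) + - b * (a * b + - b * a) by ring.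
Qed.

Lemma tdot_zero_le1 : tdot [tuple 0 : R | i < n] [tuple 0 | i < n] <= 1.
Proof. by rewrite /tdot big1 ?ler01// => i _; rewrite tnth_mktuple mul0r. Qed.

(** Composition of rotations: if (c, s) and (c', s') are points of the unit
    circle, the coefficients on the right are those of the sum of the angles. *)
Lemma tlin_comp c s c' s' t u :
  tlin c' s' (tlin c s t u) (tlin c (- s) u t) =
  tlin (c' * c - s' * s) (c' * s + s' * c) t u.
Proof. by apply: eq_from_tnth => i; rewrite !tnth_tlin; ring. Qed.

Context d (T : measurableType d).

Lemma measurable_tlin a b (f g : T -> n.-tuple R) :
  measurable_fun [set: T] f -> measurable_fun [set: T] g ->
  measurable_fun [set: T] (fun z => tlin a b (f z) (g z)).
Proof.
move=> /measurable_fun_tnthP mf /measurable_fun_tnthP mg.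
apply/measurable_fun_tnthP => i.
rewrite (_ : _ \o _ = fun z => a * tnth (f z) i + b * tnth (g z) i).
  by apply: measurable_funD; apply: measurable_funM => //; [exact: mf|exact: mg].
by apply/funext => z /=; rewrite tnth_tlin.
Qed.

Lemma measurable_tdot (f g : T -> n.-tuple R) :
  measurable_fun [set: T] f -> measurable_fun [set: T] g ->
  measurable_fun [set: T] (fun z => tdot (f z) (g z)).
Proof.
move=> /measurable_fun_tnthP mf /measurable_fun_tnthP mg.
apply: measurable_sum => i.
by apply: measurable_funM; [exact: mf|exact: mg].
Qed.

End tuples.

Section tcons.
Context {R : realType} {n : nat}.
Implicit Types (a b x y : R) (t u : n.-tuple R).

Lemma tlin_tcons a b x y t u :
  tlin a b (tcons (x, t)) (tcons (y, u)) = tcons (a * x + b * y, tlin a b t u).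
Proof.
apply: eq_from_tnth => i; rewrite tnth_tlin.
by case: (unliftP ord0 i) => [j|] ->; rewrite /= ?tnth0// !tnthS tnth_tlin.
Qed.

Lemma tdot_tcons x y t u : tdot (tcons (x, t)) (tcons (y, u)) = x * y + tdot t u.
Proof.
rewrite /tdot big_ord_recl !tnth0; congr (_ + _).
by apply: eq_bigr => i _; rewrite !tnthS.
Qed.

Lemma tuple_tcons (t : n.+1.-tuple R) : exists x u, t = tcons (x, u).
Proof.
exists (thead t), [tuple of behead t]; rewrite [LHS]tuple_eta.
exact/val_inj.
Qed.

Lemma measurable_fun_tcons d (T : measurableType d) (f : T -> R)
    (g : T -> n.-tuple R) :
  measurable_fun [set: T] f -> measurable_fun [set: T] g ->
  measurable_fun [set: T] (fun z => tcons (f z, g z)).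
Proof. exact: measurable_cons. Qed.

End tcons.

(** * Shifts and rotations of the Gaussian measure *)

Section gaussian_invariance.
Local Open Scope ereal_scope.
Context {R : realType}.
Notation gamma := (@normal_prob R 0 1).

Lemma measurable_integral_gaussian d (T : measurableType d) n
    (f : T -> n.-tuple R -> \bar R) :
  measurable_fun [set: T * n.-tuple R] (fun z => f z.1 z.2) ->
  (forall x t, 0 <= f x t) ->
  measurable_fun [set: T] (fun x => \int[gaussian n]_t f x t).
Proof.
move=> mf f0.
exact: (measurable_fun_fubini_tonelli_F (m2 := gaussian n) (fun z => f z.1 z.2)).
Qed.

Lemma integral_gaussian_swap n m (f : n.-tuple R -> m.-tuple R -> \bar R) :
  measurable_fun [set: n.-tuple R * m.-tuple R] (fun z => f z.1 z.2) ->
  (forall x t, 0 <= f x t) ->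
  \int[gaussian n]_t \int[gaussian m]_u f t u =
  \int[gaussian m]_u \int[gaussian n]_t f t u.
Proof.
move=> mf f0.
exact: (fubini_tonelli (m1 := gaussian n) (m2 := gaussian m) (fun z => f z.1 z.2)).
Qed.

(** The formula on the line, applied to one coordinate after the other. *)
Lemma cameron_martin n (y : n.-tuple R) (f : n.-tuple R -> \bar R) :
  measurable_fun [set: n.-tuple R] f -> (forall t, 0 <= f t) ->
  \int[gaussian n]_t f t = \int[gaussian n]_t
    (f (tlin 1 1 t y) * (expR (- tdot y t - tdot y y / 2))%:E).
Proof.
elim: n y f => [|n IH] y f mf f0.
  rewrite !integral_gaussian0//; last first.
    apply: emeasurable_funM; first by apply: measurableT_comp => //; exact: measurable_tlin.
    apply/measurable_EFinP/measurableT_comp => //; apply: measurable_funB => //.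
    by apply: measurableT_comp => //; exact: measurable_tdot.
  by rewrite [tlin _ _ _ _]tuple0 /tdot !big_ord0 mul0r subr0 oppr0 expR0 mule1.
have [y0 [y' ->]] := tuple_tcons y.
have mF : measurable_fun [set: n.+1.-tuple R] (fun t => f (tlin 1 1 t (tcons (y0, y'))) *
    (expR (- tdot (tcons (y0, y')) t - tdot (tcons (y0, y')) (tcons (y0, y')) / 2))%:E).
  apply: emeasurable_funM; first by apply: measurableT_comp => //; exact: measurable_tlin.
  apply/measurable_EFinP/measurableT_comp => //; apply: measurable_funB => //.
  by apply: measurableT_comp => //; exact: measurable_tdot.
rewrite (integral_gaussianS _ f mf f0) (integral_gaussianS _ _ mF); last first.
  by move=> t; apply: mule_ge0; [exact: f0|rewrite lee_fin expR_ge0].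
pose g (z : measurableTypeR R * n.-tuple R) :=
  f (tcons (z.1, tlin 1 1 z.2 y')) * (expR (- tdot y' z.2 - tdot y' y' / 2))%:E.
have mg : measurable_fun [set: _] g.
  apply: emeasurable_funM.
    apply: (measurableT_comp mf).
    by apply: measurable_fun_tcons => //; exact: measurable_tlin.
  apply/measurable_EFinP/measurableT_comp => //; apply: measurable_funB => //.
  by apply: measurableT_comp => //; exact: measurable_tdot.
have g0 z : 0 <= g z by rewrite mule_ge0// lee_fin expR_ge0.
transitivity (\int[gamma]_x \int[gaussian n]_t g (x, t)).
  apply: eq_integral => x _; apply: (IH y' (fun t => f (tcons (x, t)))) => //.
  by apply: (measurableT_comp mf); exact: measurable_fun_tcons.
have mint_g : measurable_fun [set: measurableTypeR R] (fun x => \int[gaussian n]_t g (x, t)).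
  apply: (@measurable_integral_gaussian _ (measurableTypeR R) _ (fun x t => g (x, t))).
    by under eq_fun do rewrite -surjective_pairing.
  by move=> x t; exact: g0.
apply: etrans (cameron_martin1 y0 _ mint_g _) _; first by move=> x; exact: integral_ge0.
apply: eq_integral => x _; rewrite -ge0_integralZr; last 4 first.
- exact: measurableT.
- by apply: (measurableT_comp mg); exact: measurable_fun_pair.
- by move=> t _; exact: g0.
- by rewrite lee_fin expR_ge0.
apply: eq_integral => t _; rewrite /g tlin_tcons !tdot_tcons !mul1r -muleA.
congr (_ * _); rewrite -EFinM -expRD; congr (expR _)%:E; by field.
Qed.

(** The order of integration pairs the first coordinates of the two vectors, so
    that the planar rotation can act on them. *)
Lemma integral_gaussianS2 n (f : n.+1.-tuple R -> n.+1.-tuple R -> \bar R) :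
  measurable_fun [set: n.+1.-tuple R * n.+1.-tuple R] (fun z => f z.1 z.2) ->
  (forall t u, 0 <= f t u) ->
  \int[gaussian n.+1]_t \int[gaussian n.+1]_u f t u =
  \int[gamma]_x \int[gamma]_y \int[gaussian n]_t \int[gaussian n]_u
    f (tcons (x, t)) (tcons (y, u)).
Proof.
move=> mf f0; rewrite integral_gaussianS; last 2 first.
- exact: measurable_integral_gaussian.
- by move=> t; exact: integral_ge0.
apply: eq_integral => x _.
have mfx d (T : measurableType d) (a b : T -> n.+1.-tuple R) :
    measurable_fun [set: T] a -> measurable_fun [set: T] b ->
    measurable_fun [set: T] (fun z => f (a z) (b z)).
  by move=> ma mb; exact: (measurableT_comp mf (measurable_fun_pair ma mb)).
pose k t y := \int[gaussian n]_u f (tcons (x, t)) (tcons (y, u)).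
transitivity (\int[gaussian n]_t \int[gamma]_y k t y).
  apply: eq_integral => t _; rewrite integral_gaussianS//; exact: mfx.
apply: (@fubini_tonelli _ _ _ (measurableTypeR R) R (gaussian n) gamma
  (fun z => k z.1 z.2)) => [|z]; last exact: integral_ge0.
apply: measurable_integral_gaussian => //.
apply: mfx; apply: measurable_fun_tcons => //.
  exact: (measurableT_comp measurable_fst measurable_fst).
exact: (measurableT_comp measurable_snd measurable_fst).
Qed.

(** Pairing the i-th coordinates of t and u reduces this to the invariance of the
    planar Gaussian measure under rotations. *)
Lemma gaussian_rotation n c s (f : n.-tuple R -> n.-tuple R -> \bar R) :
  (c ^+ 2 + s ^+ 2)%R = 1%R -> (0 < s)%R ->
  measurable_fun [set: n.-tuple R * n.-tuple R] (fun z => f z.1 z.2) ->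
  (forall t u, 0 <= f t u) ->
  \int[gaussian n]_t \int[gaussian n]_u f (tlin c s t u) (tlin c (- s) u t) =
  \int[gaussian n]_t \int[gaussian n]_u f t u.
Proof.
move=> cs s0; elim: n f => [|n IH] f mf f0.
  apply: eq_integral => t _; apply: eq_integral => u _.
  by congr (f _ _); rewrite [LHS]tuple0 [RHS]tuple0.
have mfx d (T : measurableType d) (a b : T -> n.+1.-tuple R) :
    measurable_fun [set: T] a -> measurable_fun [set: T] b ->
    measurable_fun [set: T] (fun z => f (a z) (b z)).
  by move=> ma mb; exact: (measurableT_comp mf (measurable_fun_pair ma mb)).
rewrite (integral_gaussianS2 n f mf f0).
rewrite (integral_gaussianS2 n (fun t u => f (tlin c s t u) (tlin c (- s) u t))); last 2 first.
- apply: mfx; apply: measurable_tlin.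
  + exact: measurable_fst.
  + exact: measurable_snd.
  + exact: measurable_snd.
  + exact: measurable_fst.
- by move=> t u; exact: f0.
pose h (z : R * R) := \int[gaussian n]_t \int[gaussian n]_u
  f (tcons (z.1, t)) (tcons (z.2, u)).
have mh : measurable_fun [set: R * R] h.
  apply: measurable_integral_gaussian => [|z t]; last exact: integral_ge0.
  apply: measurable_integral_gaussian => [|z u]; last exact: f0.
  apply: mfx; apply: measurable_fun_tcons.
  - exact: (measurableT_comp measurable_fst (measurableT_comp measurable_fst measurable_fst)).
  - exact: (measurableT_comp measurable_snd measurable_fst).
  - exact: (measurableT_comp measurable_snd (measurableT_comp measurable_fst measurable_fst)).
  - exact: measurable_snd.
have h0 z : 0 <= h z by do 2 (apply: integral_ge0 => ? _).
apply: etrans (rotation1 c s h cs s0 mh h0).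
apply: eq_integral => x _; apply: eq_integral => y _.
apply: etrans (IH (fun t u => f (tcons (_, t)) (tcons (_, u))) _ _); last 2 first.
- apply: mfx; apply: measurable_fun_tcons.
  + exact: measurable_cst.
  + exact: measurable_fst.
  + exact: measurable_cst.
  + exact: measurable_snd.
- by move=> t u; exact: f0.
apply: eq_integral => t _; apply: eq_integral => u _.
by rewrite !tlin_tcons mulNr.
Qed.
End gaussian_invariance.

(** * Laws of Gaussian vectors and moments *)

Section transfer.
Local Open Scope ereal_scope.
Context {R : realType} {disp : measure_display} {T : measurableType disp}.
Variable P : probability T R.

Lemma standard_gaussian_law n (g : {RV P >-> n.-tuple R}) :
  standard_gaussian g ->
  forall A, measurable A -> P (g @^-1` A) = gaussian n A.
Proof.
move=> [indep law] A mA.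
apply: (gaussian_unique n (distribution P g)) => // B mB.
rewrite /distribution/= /pushforward.
under eq_bigr => i _ do rewrite -(law i _ (mB i)).
rewrite -indep//; congr (P _); apply/seteqP; split => w /= h i; first by move=> _; exact: h.
exact: h.
Qed.

Lemma integral_standard_gaussian n (g : {RV P >-> n.-tuple R}) (f : n.-tuple R -> \bar R) :
  standard_gaussian g -> measurable_fun [set: n.-tuple R] f -> (forall t, 0 <= f t) ->
  \int[P]_w f (g w) = \int[gaussian n]_t f t.
Proof.
move=> sg mf f0; transitivity (\int[distribution P g]_t f t).
  by rewrite ge0_integral_distribution.
apply: eq_measure_integral => A mA _; exact: standard_gaussian_law.
Qed.

Lemma integral_standard_gaussian2 m d (g : {RV P >-> m.-tuple R})
    (h : {RV P >-> d.-tuple R}) (f : m.-tuple R -> d.-tuple R -> \bar R) :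
  standard_gaussian g -> standard_gaussian h -> independent_vectors g h ->
  measurable_fun [set: m.-tuple R * d.-tuple R] (fun z => f z.1 z.2) ->
  (forall t u, 0 <= f t u) ->
  \int[P]_w f (g w) (h w) = \int[gaussian m]_t \int[gaussian d]_u f t u.
Proof.
move=> sg sh gh mf f0.
have mgh : measurable_fun [set: T] (fun w => (g w, h w)) by exact: measurable_fun_pair.
pose gh_ : {mfun T >-> (m.-tuple R * d.-tuple R)%type} :=
  HB.pack (fun w => (g w, h w)) (isMeasurableFun.Build _ _ _ _ _ mgh).
transitivity (\int[distribution P gh_]_z f z.1 z.2).
  by rewrite ge0_integral_distribution.
transitivity (\int[(gaussian m \x gaussian d)]_z f z.1 z.2); last first.
  exact: (fubini_tonelli1 (fun z => f z.1 z.2)).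
apply: eq_measure_integral => A mA _.
apply/esym/product_measure_unique => // E F mE mF.
apply: etrans (gh E F mE mF) _.
by congr (_ * _); exact: standard_gaussian_law.
Qed.

End transfer.

Section moments.
Local Open Scope ereal_scope.
Context {R : realType} {n : nat}.
Implicit Types t y : n.-tuple R.

Implicit Types f k : n.-tuple R -> \bar R.

Lemma le_integral_gaussian f k : (forall t, 0 <= f t) ->
  measurable_fun [set: n.-tuple R] f -> measurable_fun [set: n.-tuple R] k ->
  (forall t, f t <= k t) -> \int[gaussian n]_t f t <= \int[gaussian n]_t k t.
Proof. by move=> f0 mf mk fk; apply: ge0_le_integral. Qed.

Lemma integral_gaussianD f k : (forall t, 0 <= f t) -> (forall t, 0 <= k t) ->
  measurable_fun [set: n.-tuple R] f -> measurable_fun [set: n.-tuple R] k ->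
  \int[gaussian n]_t (f t + k t) = \int[gaussian n]_t f t + \int[gaussian n]_t k t.
Proof. by move=> f0 k0 mf mk; rewrite ge0_integralD. Qed.

Lemma integral_gaussianZl (r : R) f : (0 <= r)%R -> (forall t, 0 <= f t) ->
  measurable_fun [set: n.-tuple R] f ->
  \int[gaussian n]_t (r%:E * f t) = r%:E * \int[gaussian n]_t f t.
Proof. by move=> r0 f0 mf; rewrite ge0_integralZl. Qed.

Lemma integral_gaussian_cst (r : R) : \int[gaussian n]_t r%:E = r%:E.
Proof.
rewrite integral_cst// -[RHS]mule1; congr (_ * _); exact: probability_setT.
Qed.

(** Cameron-Martin with shift y turns the integrand into a constant. *)
Lemma gaussian_mgf y :
  \int[gaussian n]_t (expR (tdot y t))%:E = (expR (tdot y y / 2))%:E.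
Proof.
rewrite (cameron_martin n y); last 2 first.
- by apply/measurable_EFinP/measurableT_comp => //; exact: measurable_tdot.
- by move=> t; rewrite lee_fin expR_ge0.
rewrite (eq_integral (cst (expR (tdot y y / 2))%:E)); last first.
  move=> t _; rewrite -EFinM -expRD tdotC tdot_linl (tdotC t).
  by congr (expR _)%:E; field.
exact: integral_gaussian_cst.
Qed.

(** Compares second moments with exponential moments; the constant is not
    optimal. *)
Lemma sqr_le_expR (u : R) : (u ^+ 2 <= 4 * (expR u + expR (- u)))%R.
Proof.
have H (v : R) : (0 <= v -> v ^+ 2 <= 4 * expR v)%R.
  move=> v0; have -> : v = (v / 2 + v / 2)%R by field.
  rewrite expRD -expr2; have := expR_ge1Dx (v / 2); set e := expR _ => he.
  nra.
have := expR_ge0 u; have := expR_ge0 (- u).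
have [/H|/ltW] := leP 0%R u; first by lra.
by rewrite -oppr_ge0 => /H; rewrite sqrrN; lra.
Qed.

Lemma expR_half_le2 : (expR (1 / 2) <= 2 :> R)%R.
Proof.
have := expR_ge1Dx (- (1 / 2) : R); rewrite expRN => h.
have e0 := expR_gt0 (1 / 2 : R).
by rewrite -[leRHS]invrK -[leLHS]invrK lef_pV2 ?posrE ?invr_gt0//; lra.
Qed.

(** The true value is y . y. The crude constant comes from the Laplace
    transform of the normalized form, through sqr_le_expR. *)
Lemma gaussian_second_moment y :
  \int[gaussian n]_t (tdot y t ^+ 2)%:E <= (16 * tdot y y)%:E.
Proof.
have [y0|yN0] := eqVneq (tdot y y) 0%R.
  by rewrite integral0_eq ?y0 ?mulr0// => t _; rewrite tdot_eq0// expr0n.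
pose s := Num.sqrt (tdot y y).
have s2 : (s ^+ 2 = tdot y y)%R by rewrite sqr_sqrtr// tdot_ge0.
have s0 : (0 < s)%R by rewrite sqrtr_gt0 lt_neqAle eq_sym yN0 tdot_ge0.
have sN0 : s != 0%R by rewrite gt_eqF.
pose z := tlin s^-1 0 y y.
have zE t : tdot z t = (s^-1 * tdot y t)%R by rewrite tdot_scalel.
have zz : tdot z z = 1%R by rewrite zE tdotC zE -s2; field.
pose z' := tlin (-1) 0 z z.
have z'E t : tdot z' t = (- tdot z t)%R by rewrite tdot_scalel mulN1r.
have zz' : tdot z' z' = 1%R by rewrite z'E tdotC z'E opprK.
have mexp (u : n.-tuple R) : measurable_fun [set: n.-tuple R] (fun t => (expR (tdot u t))%:E).
  by apply/measurable_EFinP/measurableT_comp => //; exact: measurable_tdot.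
have exp0 (u t : n.-tuple R) : 0 <= (expR (tdot u t))%:E by rewrite lee_fin expR_ge0.
apply: (@le_trans _ _ (\int[gaussian n]_t
    ((s ^+ 2 * 4)%:E * ((expR (tdot z t))%:E + (expR (tdot z' t))%:E)))).
  apply: ge0_le_integral => //.
  - by move=> t _; rewrite lee_fin sqr_ge0.
  - by apply/measurable_EFinP/measurable_funX; exact: measurable_tdot.
  - by apply: measurable_funeM; exact: emeasurable_funD.
  - move=> t _; rewrite -EFinD -EFinM lee_fin z'E.
    have -> : tdot y t = (s * tdot z t)%R by rewrite zE mulrA divff// mul1r.
    by rewrite exprMn -[leRHS]mulrA ler_pM2l ?exprn_gt0// sqr_le_expR.
rewrite ge0_integralZl//; last 3 first.
- exact: emeasurable_funD.
- by move=> t _; rewrite adde_ge0.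
- by rewrite lee_fin mulr_ge0// sqr_ge0.
rewrite ge0_integralD// !gaussian_mgf zz zz' -EFinD -EFinM lee_fin -s2.
have := expR_half_le2; have := sqr_ge0 s; nra.
Qed.

End moments.

(** * Maxima of finite families *)

Section bigmax0.
Context {R : realType} {I : eqType}.
Implicit Types (l : seq I) (f : I -> R).

(** For families of nonnegative numbers the default value 0 is harmless, and it
    makes the empty maximum meaningful. *)
Definition bigmax0 l f : R := \big[Num.max/0]_(i <- l) f i.

Lemma bigmax0_ge0 l f : 0 <= bigmax0 l f.
Proof.
by rewrite /bigmax0; elim: l => [|i l IH]; rewrite ?big_nil// big_cons le_max IH orbT.
Qed.

Lemma le_bigmax0 l f i : i \in l -> f i <= bigmax0 l f.
Proof.
rewrite /bigmax0; elim: l => [//|j l IH]; rewrite inE big_cons le_max.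
by case/orP => [/eqP ->|/IH ->]; rewrite ?lexx ?orbT.
Qed.

Lemma bigmax0_attained l f :
  bigmax0 l f = 0 \/ exists2 i, i \in l & bigmax0 l f = f i.
Proof.
rewrite /bigmax0; elim: l => [|i l IH]; first by rewrite big_nil; left.
rewrite big_cons; case: leP => _; last by right; exists i; rewrite ?mem_head.
case: IH => [->|[j jl ->]]; [by left|right; exists j => //].
by rewrite inE jl orbT.
Qed.

Lemma bigmax0_le l f M : 0 <= M -> (forall i, i \in l -> f i <= M) -> bigmax0 l f <= M.
Proof. by move=> M0 fM; case: (bigmax0_attained l f) => [->//|[i il ->]]; exact: fM. Qed.

Lemma measurable_bigmax0 d (T : measurableType d) l (f : I -> T -> R) :
  (forall i, measurable_fun [set: T] (f i)) ->
  measurable_fun [set: T] (fun z => bigmax0 l (f ^~ z)).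
Proof.
move=> mf; rewrite /bigmax0; elim: l => [|i l IH].
  by under eq_fun do rewrite big_nil; exact: measurable_cst.
by under eq_fun do rewrite big_cons; exact: measurable_maxr.
Qed.

End bigmax0.

Section maxdot.
Context {R : realType} {n : nat}.
Implicit Types (l : seq (n.-tuple R)) (t : n.-tuple R).

Definition maxdot l t : R := bigmax0 l (fun a => `|tdot t a|).

Lemma measurable_maxdot d (T : measurableType d) l (g : T -> n.-tuple R) :
  measurable_fun [set: T] g -> measurable_fun [set: T] (fun z => maxdot l (g z)).
Proof.
move=> mg; apply: (measurable_bigmax0 _ _ l (fun a z => `|tdot (g z) a|)) => a.
apply: measurableT_comp => //.
by apply: measurable_tdot; [exact: mg|exact: measurable_cst].
Qed.

Local Open Scope ereal_scope.

(** The exponential of a maximum is at most the sum of the exponentials. *)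
Lemma maxdot_exp_moment l :
  \int[gaussian n]_t (expR (2 * maxdot l t))%:E < +oo.
Proof.
elim: l => [|a l IH].
  rewrite (eq_integral (cst 1)); last first.
    by move=> t _; rewrite /maxdot /bigmax0 big_nil mulr0 expR0.
  by rewrite integral_gaussian_cst ltry.
pose M := maxdot l.
pose z (x : R) := tlin x 0 a a.
have zE x t : tdot (z x) t = (x * tdot t a)%R by rewrite tdot_scalel tdotC.
have mz x : measurable_fun [set: n.-tuple R] (fun t => (expR (tdot (z x) t))%:E).
  apply/measurable_EFinP/measurableT_comp => //.
  by apply: measurable_tdot; [exact: measurable_cst|exact: measurable_id].
have z0 x t : 0 <= (expR (tdot (z x) t))%:E by rewrite lee_fin expR_ge0.
have mM l' : measurable_fun [set: n.-tuple R] (fun t => (expR (2 * maxdot l' t))%:E).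
  apply/measurable_EFinP/measurableT_comp => //; apply: measurable_funM => //.
  by apply: measurable_maxdot; exact: measurable_id.
have M0 t : 0 <= (expR (2 * M t))%:E by rewrite lee_fin expR_ge0.
apply: (@le_lt_trans _ _ (\int[gaussian n]_t
    (((expR (tdot (z 2) t))%:E + (expR (tdot (z (-2)) t))%:E) + (expR (2 * M t))%:E))).
  apply: le_integral_gaussian.
  - by move=> t; rewrite lee_fin expR_ge0.
  - exact: mM.
  - apply: emeasurable_funD; last exact: mM.
    by apply: emeasurable_funD; exact: mz.
  - move=> t; rewrite -!EFinD lee_fin /maxdot /bigmax0 big_cons -/(bigmax0 _ _) -/(maxdot _ _) -/(M t).
    rewrite !zE mulNr.
    have e1 := expR_ge0 (2 * tdot t a); have e2 := expR_ge0 (- (2 * tdot t a)).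
    have e3 := expR_ge0 (2 * M t).
    case: (leP `|tdot t a|%R (M t)) => _; first by lra.
    case: (ger0P (tdot t a)) => _; first by lra.
    by rewrite mulrN; lra.
rewrite integral_gaussianD; last 4 first.
- by move=> t; rewrite adde_ge0.
- exact: M0.
- by apply: emeasurable_funD; exact: mz.
- exact: mM.
rewrite integral_gaussianD; last 4 first.
- exact: z0.
- exact: z0.
- exact: mz.
- exact: mz.
rewrite (gaussian_mgf (z 2%R)) (gaussian_mgf (z (-2)%R)) -EFinD; apply: lte_add_pinfty; [exact: ltry|exact: IH].
Qed.

End maxdot.

(** * Concentration of a maximum of Gaussian linear forms *)

Section concentration.
Context {R : realType} {n : nat}.
Variables (l : seq (n.-tuple R)) (K : R).
Hypothesis lK : forall a, a \in l -> tdot a a <= K ^+ 2.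
Implicit Types t u v b : n.-tuple R.

Let F : n.-tuple R -> R := maxdot l.

(** The maximum is convex: at t it equals, and everywhere it dominates, the
    linear form +- a for which |t . a| is maximal, or 0 if the maximum is 0. *)
Lemma maxdot_subgradient t : exists b,
  [/\ F t = tdot t b, forall v, tdot v b <= F v & tdot b b <= K ^+ 2].
Proof.
have tdotZ a (x : R) v : tdot v (tlin x 0 a a) = x * tdot v a.
  by rewrite tdotC tdot_scalel tdotC.
case: (bigmax0_attained l (fun a => `|tdot t a|)) => [F0|[a al Fa]].
  exists (tlin 0 0 t t); split => [|v|]; rewrite !tdotZ mul0r ?sqr_ge0//.
  exact: bigmax0_ge0.
exists (tlin (Num.sg (tdot t a)) 0 a a); split => [|v|]; rewrite ?tdotZ.
- by rewrite /F /maxdot Fa normrEsg.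
- apply: le_trans (@le_bigmax0 _ _ l (fun a => `|tdot v a|) _ al).
  rewrite (le_trans (ler_norm _))// normrM.
  by rewrite ler_piMl//; case: sgrP; rewrite ?normr0 ?normr1 ?normrN1.
- rewrite tdot_scalel mulrA.
  apply: le_trans (lK _ al); rewrite ler_piMl ?tdot_ge0//.
  by case: sgrP; rewrite ?mulr0 ?mulr1 ?mulrNN ?mulr1.
Qed.

Let F_ge0 t : 0 <= F t. Proof. exact: bigmax0_ge0. Qed.

Local Open Scope ereal_scope.

(** Exponential moment of the increment of F along the rotation of angle theta
    with (c, s) = (cos theta, sin theta). *)
Let Psi c s lam : \bar R := \int[gaussian n]_t \int[gaussian n]_u
  (expR (lam * (F t - F (tlin c s t u))))%:E.

Let measurable_expF d (T : measurableType d) (g : T -> n.-tuple R) lam :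
  measurable_fun [set: T] g ->
  measurable_fun [set: T] (fun z => (expR (lam * F (g z)))%:E).
Proof.
move=> mg; apply/measurable_EFinP; apply: measurableT_comp => //.
by apply: measurable_funM => //; exact: measurable_maxdot.
Qed.

Let measurable_expFB d (T : measurableType d) (g h : T -> n.-tuple R) lam :
  measurable_fun [set: T] g -> measurable_fun [set: T] h ->
  measurable_fun [set: T] (fun z => (expR (lam * (F (g z) - F (h z))))%:E).
Proof.
move=> mg mh; apply/measurable_EFinP; apply: measurableT_comp => //.
by apply: measurable_funM => //; apply: measurable_funB; exact: measurable_maxdot.
Qed.

(** At fixed t the increment is bounded by a linear form in u, whose exponential
    moment is explicit. For a small angle 1 - c is of second order. *)
Lemma Psi_step c s lam : (0 <= lam)%R -> 
  Psi c s lam <= \int[gaussian n]_t (expR (lam * (1 - c) * F t))%:E *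
                 (expR ((lam * s) ^+ 2 * K ^+ 2 / 2))%:E.
Proof.
move=> lam0; rewrite -ge0_integralZr//; last exact: measurable_expF.
apply: ge0_le_integral => //.
- by move=> t _; apply: integral_ge0 => u _; rewrite lee_fin expR_ge0.
- apply: measurable_integral_gaussian => [|t u]; last by rewrite lee_fin expR_ge0.
  by apply: measurable_expFB => //; exact: measurable_tlin.
- by apply: emeasurable_funM => //; exact: measurable_expF.
move=> t _; have [b [Ft Fb bK]] := maxdot_subgradient t.
pose z := tlin (- (lam * s)) 0 b b.
have zE u : tdot z u = (- (lam * s) * tdot u b)%R.
  by rewrite tdot_scalel tdotC.
have mz : measurable_fun [set: n.-tuple R] (fun u => (expR (tdot z u))%:E).
  by apply/measurable_EFinP/measurableT_comp => //; exact: measurable_tdot.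
apply: (@le_trans _ _ (\int[gaussian n]_u
    ((expR (lam * (1 - c) * F t))%:E * (expR (tdot z u))%:E))).
  apply: ge0_le_integral => //.
  - by apply: measurable_expFB => //; exact: measurable_tlin.
  - exact: measurable_funeM.
  - move=> u _; rewrite -EFinM -expRD lee_fin ler_expR zE.
    have := Fb (tlin c s t u); rewrite tdot_linl -Ft; nra.
rewrite ge0_integralZl//.
rewrite gaussian_mgf lee_wpmul2l ?lee_fin ?expR_ge0// ler_expR.
rewrite zE tdot_scalel; have := sqr_ge0 (lam * s); nra.
Qed.

(** The increment over the double angle is the sum of two increments over the
    single angle, which have the same law by rotation invariance. Convexity of
    the exponential then gives exp (a + b) <= (exp (2 a) + exp (2 b)) / 2. *)
Lemma Psi_double c s lam : (c ^+ 2 + s ^+ 2)%R = 1%R -> (0 < s)%R ->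
  Psi (c * c - s * s)%R (c * s + s * c)%R lam <= Psi c s (2 * lam)%R.
Proof.
move=> cs s0.
pose f t u := (expR (2 * lam * (F t - F (tlin c s t u))))%:E.
have f0 t u : 0 <= f t u by rewrite lee_fin expR_ge0.
have mf d (T : measurableType d) (g h : T -> n.-tuple R) :
    measurable_fun [set: T] g -> measurable_fun [set: T] h ->
    measurable_fun [set: T] (fun z => f (g z) (h z)).
  by move=> mg mh; apply: measurable_expFB => //; exact: measurable_tlin.
pose f1 t u := f (tlin c s t u) (tlin c (- s) u t).
have f10 t u : 0 <= f1 t u by exact: f0.
have mf1 d (T : measurableType d) (g h : T -> n.-tuple R) :
    measurable_fun [set: T] g -> measurable_fun [set: T] h ->
    measurable_fun [set: T] (fun z => f1 (g z) (h z)).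
  by move=> mg mh; apply: mf; exact: measurable_tlin.
have rot : \int[gaussian n]_t \int[gaussian n]_u f1 t u =
    \int[gaussian n]_t \int[gaussian n]_u f t u.
  apply: gaussian_rotation => [|||t u]; [exact: cs|exact: s0| |exact: f0].
  exact: (mf _ _ fst snd measurable_fst measurable_snd).
have mint (k : n.-tuple R -> n.-tuple R -> \bar R) : (forall t u, 0 <= k t u) ->
    (forall d (T : measurableType d) (g h : T -> n.-tuple R),
    measurable_fun [set: T] g -> measurable_fun [set: T] h ->
    measurable_fun [set: T] (fun z => k (g z) (h z))) ->
    measurable_fun [set: n.-tuple R] (fun t => \int[gaussian n]_u k t u).
  move=> k0 mk; apply: measurable_integral_gaussian => [|t u]; last exact: k0.
  exact: (mk _ _ fst snd measurable_fst measurable_snd).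
have mft t : measurable_fun [set: n.-tuple R] (f t).
  by apply: (mf _ _ (cst t) id); [exact: measurable_cst|exact: measurable_id].
have mf1t t : measurable_fun [set: n.-tuple R] (f1 t).
  by apply: (mf1 _ _ (cst t) id); [exact: measurable_cst|exact: measurable_id].
have If0 t : 0 <= \int[gaussian n]_u f t u by apply: integral_ge0 => u _; exact: f0.
have If10 t : 0 <= \int[gaussian n]_u f1 t u by apply: integral_ge0 => u _; exact: f10.
have half0 : (0 <= 2^-1 :> R)%R by rewrite invr_ge0 ler0n.
have half x : 0 <= x -> (2^-1)%:E * (x + x) = x :> \bar R.
  case: x => [x _|_|//]; first by rewrite -EFinD -EFinM; congr EFin; field.
  by apply: gt0_muley; rewrite lte_fin invr_gt0 ltr0n.
pose I k := \int[gaussian n]_t \int[gaussian n]_u k t u : \bar R.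
have If : 0 <= I f by apply: integral_ge0 => t _; exact: If0.
have avg : (2^-1)%:E * (I f + I f1) = Psi c s (2 * lam)%R.
  exact: etrans (congr1 (fun x => (2^-1)%:E * (I f + x)) rot) (half _ If).
suff h : Psi (c * c - s * s)%R (c * s + s * c)%R lam <= (2^-1)%:E * (I f + I f1).
  by rewrite -avg.
rewrite /I.
rewrite -(integral_gaussianD _ _ If0 If10 (mint _ f0 mf) (mint _ f10 mf1)).
rewrite -(integral_gaussianZl _ _ half0); last 2 first.
- by move=> t; apply: adde_ge0; [exact: If0|exact: If10].
- by apply: emeasurable_funD; [exact: mint f0 mf|exact: mint f10 mf1].
apply: le_integral_gaussian.
- by move=> t; apply: integral_ge0 => u _; rewrite lee_fin expR_ge0.
- apply: measurable_integral_gaussian => [|t u]; last by rewrite lee_fin expR_ge0.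
  apply: measurable_expFB; first exact: measurable_fst.
  by apply: measurable_tlin; [exact: measurable_fst|exact: measurable_snd].
- apply: measurable_funeM; apply: emeasurable_funD; [exact: mint f0 mf|exact: mint f10 mf1].
move=> t; rewrite -(integral_gaussianD _ _ (f0 t) (f10 t) (mft t) (mf1t t)).
rewrite -(integral_gaussianZl _ _ half0); last 2 first.
- by move=> u; apply: adde_ge0; [exact: f0|exact: f10].
- by apply: emeasurable_funD; [exact: mft|exact: mf1t].
apply: le_integral_gaussian.
- by move=> u; rewrite lee_fin expR_ge0.
- apply: measurable_expFB; first exact: measurable_cst.
  by apply: measurable_tlin; [exact: measurable_cst|exact: measurable_id].
- by apply: measurable_funeM; apply: emeasurable_funD; [exact: mft|exact: mf1t].
move=> u; rewrite /f1/f -EFinD -EFinM lee_fin tlin_comp.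
set a := F t; set b := F (tlin c s t u); set e := F _.
have -> : (lam * (a - e) = lam * (a - b) + lam * (b - e))%R by ring.
rewrite expRD -!mulrA !(mulrC 2%R) !expRM_natr.
set x := expR _; set y := expR _; have := sqr_ge0 (x - y)%R; nra.
Qed.

(** Psi_double iterated from the right angle, with (c, s) obtained by the
    half-angle formulas. The bound 2 ^ k.+1 * s <= 2 * c is on the tangent, which
    is at least halved with the angle, starting from the value 1 at pi / 4. *)
Lemma Psi_halve lam k : exists c s,
  [/\ (0 <= c <= 1)%R, (0 < s)%R, (c ^+ 2 + s ^+ 2 = 1)%R,
      (2 ^+ k.+1 * s <= 2 * c)%R &
      Psi 0%R 1%R lam <= Psi c s (2 ^+ k.+1 * lam)%R].
Proof.
elim: k => [|k [c [s [/andP[c0 c1] s0 cs bnd IH]]]].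
  pose r : R := Num.sqrt 2^-1.
  have r2 : (r ^+ 2 = 2^-1)%R by rewrite sqr_sqrtr// invr_ge0.
  have r0 : (0 < r)%R by rewrite sqrtr_gt0 invr_gt0.
  exists r, r; split.
  - by rewrite ltW//=; nra.
  - exact: r0.
  - by rewrite r2; field.
  - by rewrite expr1.
  - have := Psi_double r r lam _ r0; rewrite expr1 r2.
    have -> : (r * r - r * r = 0)%R by ring.
    have -> : (r * r + r * r = 1)%R by rewrite -!expr2 r2; field.
    by apply; field.
pose c' : R := Num.sqrt ((1 + c) / 2).
have c'2 : (c' ^+ 2 = (1 + c) / 2)%R by rewrite sqr_sqrtr//; lra.
have c'0 : (0 < c')%R by rewrite sqrtr_gt0; lra.
have c'N0 : (c' != 0)%R by rewrite gt_eqF.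
pose s' : R := (s / (2 * c'))%R.
have s'E : (2 * c' * s' = s)%R by rewrite /s'; field.
have s'0 : (0 < s')%R by rewrite divr_gt0// mulr_gt0.
have c's' : (c' ^+ 2 + s' ^+ 2 = 1)%R.
  have : (4 * c' ^+ 2 * s' ^+ 2 = s ^+ 2)%R by rewrite -s'E; ring.
  rewrite c'2 => h.
  have : (2 * (1 + c) * ((1 + c) / 2 + s' ^+ 2 - 1) = 0)%R.
    transitivity ((1 + c) ^+ 2 - 2 * (1 + c) + (4 * ((1 + c) / 2) * s' ^+ 2))%R; first by field.
    by rewrite h; transitivity (c ^+ 2 + s ^+ 2 - 1)%R; [ring|rewrite cs subrr].
  move/eqP; rewrite mulf_eq0 => /orP[/eqP|/eqP]; first by lra.
  by move/eqP; rewrite subr_eq0 => /eqP.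
exists c', s'; split.
- by apply/andP; split; [exact: ltW|nra].
- exact: s'0.
- exact: c's'.
- have e : (2 ^+ k.+2 * s' * c' = 2 ^+ k.+1 * s)%R.
    by rewrite -s'E [X in (X * _ * _)%R]exprS; ring.
  rewrite -(ler_pM2r c'0) e; apply: (le_trans bnd).
  by rewrite -mulrA -expr2 c'2; lra.
- apply: (le_trans IH).
  have -> : (2 ^+ k.+2 * lam = 2 * (2 ^+ k.+1 * lam))%R by rewrite exprS mulrA.
  have := Psi_double c' s' (2 ^+ k.+1 * lam) c's' s'0.
  have -> : (c' * s' + s' * c' = s)%R by rewrite -s'E; ring.
  suff -> : (c' * c' - s' * s' = c)%R by [].
  by rewrite -!expr2; lra.
Qed.

(** Since exp (eta F) <= 1 + eta F exp (eta F) <= 1 + eta exp (2 F) for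
    eta <= 1, any bound on the exponential moment of 2 F determines eta0. *)
Lemma maxdot_small_exp : exists2 eta0 : R, (0 < eta0)%R & forall eta,
  (0 <= eta <= eta0)%R -> \int[gaussian n]_t (expR (eta * F t))%:E <= 2%:E.
Proof.
have := maxdot_exp_moment l; rewrite -/F.
have M0 : 0 <= \int[gaussian n]_t (expR (2 * F t))%:E.
  by apply: integral_ge0 => t _; rewrite lee_fin expR_ge0.
have mF lam : measurable_fun [set: n.-tuple R] (fun t => (expR (lam * F t))%:E).
  by apply: measurable_expF; exact: measurable_id.
move: M0; case ME : (\int[gaussian n]_t (expR (2 * F t))%:E) => [M| |]// M0 _.
rewrite lee_fin in M0.
have M1 : (0 < 1 + M)%R by lra.
exists (1 + M)^-1%R; first by rewrite invr_gt0.
move=> eta /andP[eta0]; rewrite -(ler_pM2r M1) mulVf ?gt_eqF// => etaM.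
have eta1 : (eta <= 1)%R by nra.
apply: (@le_trans _ _ (\int[gaussian n]_t (1%:E + eta%:E * (expR (2 * F t))%:E))).
  apply: le_integral_gaussian.
  - by move=> t; rewrite lee_fin expR_ge0.
  - exact: mF.
  - by apply: emeasurable_funD; [exact: measurable_cst|apply: measurable_funeM; exact: mF].
  - move=> t; rewrite -EFinM -EFinD lee_fin.
    have x0 := F_ge0 t; set x := F t in x0 *.
    have h1 : (expR (eta * x) <= 1 + eta * x * expR (eta * x))%R.
      have := expR_ge1Dx (- (eta * x)).
      rewrite -(ler_pM2r (expR_gt0 (eta * x))) -expRD addNr expR0; lra.
    apply: (le_trans h1); rewrite lerD2l -mulrA ler_wpM2l//.
    rewrite (_ : 2 * x = x + x)%R; last by ring.
    rewrite expRD ler_pM ?expR_ge0//; first by have := expR_ge1Dx x; lra.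
    by rewrite ler_expR ler_piMl.
rewrite integral_gaussianD; last 4 first.
- by move=> t; rewrite lee_fin.
- by move=> t; rewrite -EFinM lee_fin mulr_ge0// expR_ge0.
- exact: measurable_cst.
- by apply: measurable_funeM; exact: mF.
rewrite integral_gaussianZl//.
rewrite integral_gaussian_cst ME -EFinM -EFinD lee_fin; lra.
Qed.

(** At the right angle Psi 0 1 lam = E exp (lam F) E exp (- lam F), and the second
    factor is at least exp (- lam m) by Jensen's inequality. Halving the angle k
    times multiplies lam by 2 ^ k: the variance term of Psi_step stays bounded
    because 2 ^ k s does, and the other one, the exponential moment of
    2 ^ k (1 - c) lam F, is at most 2 for large k because 2 ^ k (1 - c) tends to
    0. *)
Lemma maxdot_concentration (m lam : R) : (0 <= lam)%R ->
  \int[gaussian n]_t (F t)%:E <= m%:E ->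
  \int[gaussian n]_t (expR (lam * F t))%:E <=
    (2 * expR (lam * m + 2 * lam ^+ 2 * K ^+ 2))%:E.
Proof.
move=> lam0 Fm.
have mF x : measurable_fun [set: n.-tuple R] (fun t => (expR (x * F t))%:E).
  by apply: measurable_expF; exact: measurable_id.
have mF1 : measurable_fun [set: n.-tuple R] (fun t => (F t)%:E).
  by apply/measurable_EFinP; apply: measurable_maxdot; exact: measurable_id.
have exp0 x t : 0 <= (expR (x * F t))%:E by rewrite lee_fin expR_ge0.
set E := \int[gaussian n]_t (expR (lam * F t))%:E.
have E0 : 0 <= E by apply: integral_ge0 => t _; exact: exp0.
set E' := \int[gaussian n]_t (expR (- lam * F t))%:E.
have E'1 : E' <= 1%:E.
  apply: (@le_trans _ _ (\int[gaussian n]_t 1%:E)); last by rewrite integral_gaussian_cst.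
  apply: le_integral_gaussian.
  - exact: exp0.
  - exact: mF.
  - exact: measurable_cst.
  - by move=> t; rewrite lee_fin -expR0 ler_expR mulNr oppr_le0 mulr_ge0.
have E'0 : 0 <= E' by apply: integral_ge0 => t _; exact: exp0.
have PsiE : Psi 0%R 1%R lam = E * E'.
  rewrite muleC -(fineK (x := E')); last first.
    by rewrite ge0_fin_numE// (le_lt_trans E'1)// ltry.
  rewrite -(integral_gaussianZl _ _ (fine_ge0 E'0) (exp0 lam) (mF lam)).
  apply: eq_integral => t _; rewrite fineK; last first.
    by rewrite ge0_fin_numE// (le_lt_trans E'1)// ltry.
  rewrite muleC -(integral_gaussianZl _ _ (expR_ge0 _) (exp0 (- lam)) (mF (- lam)))%R.
  apply: eq_integral => u _; rewrite -EFinM -expRD; congr (expR _)%:E.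
  suff -> : tlin 0 1 t u = u by ring.
  by apply: eq_from_tnth => i; rewrite tnth_tlin mul0r add0r mul1r.
(* Jensen's inequality, through the tangent line of the exponential at m; m only
   has to bound the mean of F from above because the line is decreasing. *)
have Em : (expR (- (lam * m)))%:E <= E'.
  set e := expR _.
  have e0 : (0 <= e)%R by exact: expR_ge0.
  have m0 : (0 <= m)%R.
    by rewrite -lee_fin (le_trans _ Fm)// integral_ge0// => t _; rewrite lee_fin.
  have : (e * (1 + lam * m))%:E <= E' + (e * lam)%:E * m%:E.
    apply: (@le_trans _ _ (E' + (e * lam)%:E * \int[gaussian n]_t (F t)%:E)); last first.
      by apply: leeD2l => //; apply: lee_wpmul2l => //; rewrite lee_fin mulr_ge0.
    rewrite -integral_gaussianZl; last 3 first.
    - exact: mulr_ge0.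
    - by move=> t; rewrite lee_fin.
    - exact: mF1.
    rewrite -integral_gaussianD; last 4 first.
    - exact: exp0.
    - by move=> t; rewrite -EFinM lee_fin mulr_ge0// mulr_ge0.
    - exact: mF.
    - by apply: measurable_funeM; exact: mF1.
    rewrite -[leLHS](integral_gaussian_cst (n := n)); apply: le_integral_gaussian.
    - by move=> t; rewrite lee_fin mulr_ge0// addr_ge0// mulr_ge0.
    - exact: measurable_cst.
    - by apply: emeasurable_funD; [exact: mF|apply: measurable_funeM; exact: mF1].
    - move=> t; rewrite -EFinM -EFinD lee_fin.
      have -> : (- lam * F t = - (lam * m) + (lam * m - lam * F t))%R by ring.
      rewrite expRD -/e; have := expR_ge1Dx (lam * m - lam * F t); nra.
  rewrite -(fineK (x := E')); last by rewrite ge0_fin_numE// (le_lt_trans E'1)// ltry.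
  by rewrite -EFinM -EFinD !lee_fin; lra.
have [eta0 eta00 small] := maxdot_small_exp.
have [k klam] : exists k, (4 * lam <= eta0 * 2 ^+ k.+1)%R.
  exists (Num.truncn (4 * lam / eta0)).
  rewrite [leRHS]mulrC -ler_pdivrMr//.
  set x := (4 * lam / eta0)%R.
  have x0 : (0 <= x)%R by rewrite divr_ge0 ?mulr_ge0// ltW.
  apply: le_trans (ltW (truncnS_gt x)) _.
  by rewrite -natrX ler_nat ltnW// ltn_expl.
have [c [s [/andP[c0 c1] s0 cs bnd PsiL]]] := Psi_halve lam k.
have p0 : (0 < 2 ^+ k.+1 :> R)%R by rewrite exprn_gt0.
have h := le_trans PsiL (Psi_step c s _ (mulr_ge0 (ltW p0) lam0)).
rewrite PsiE in h.
have {h} h : E * (expR (- (lam * m)))%:E <= 2%:E * (expR (2 * lam ^+ 2 * K ^+ 2))%:E.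
  apply: (le_trans (lee_wpmul2l E0 Em)); apply: (le_trans h).
  apply: lee_pmul.
  - by apply: integral_ge0 => t _; exact: exp0.
  - by rewrite lee_fin expR_ge0.
  - apply: small; apply/andP; split.
      by rewrite mulr_ge0 ?subr_ge0// mulr_ge0// ltW.
    set p := (2 ^+ k.+1)%R in p0 bnd klam *.
    have cs2 : (1 - c <= s ^+ 2)%R.
      by have : (0 <= c * (1 - c))%R; [rewrite mulr_ge0// subr_ge0|nra].
    have ps0 : (0 <= p * s)%R by rewrite mulr_ge0// ltW.
    have ps2 : ((p * s) ^+ 2 <= 4)%R by nra.
    rewrite -(ler_pM2r p0); apply: le_trans klam.
    have p2 : (p * p * (1 - c) <= 4)%R.
      apply: le_trans ps2; rewrite exprMn -expr2.
      by rewrite ler_wpM2l// sqr_ge0.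
    have -> : (p * lam * (1 - c) * p = lam * (p * p * (1 - c)))%R by ring.
    by rewrite [leRHS]mulrC ler_wpM2l.
  - rewrite lee_fin ler_expR; set p := (2 ^+ k.+1)%R in p0 bnd *.
    have ps0 : (0 <= p * s)%R by rewrite mulr_ge0// ltW.
    have ps2 : ((p * s) ^+ 2 <= 4)%R by nra.
    have lK0 : (0 <= lam ^+ 2 * K ^+ 2)%R by rewrite mulr_ge0 ?sqr_ge0.
    have -> : ((p * lam * s) ^+ 2 * K ^+ 2 / 2 = (p * s) ^+ 2 * (lam ^+ 2 * K ^+ 2) / 2)%R.
      by field.
    nra.
have em0 : 0 <= (expR (lam * m))%:E by rewrite lee_fin expR_ge0.
have := lee_wpmul2r em0 h.
rewrite -!muleA -!EFinM -!expRD addNr expR0 mule1 => /le_trans; apply.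
by rewrite [X in expR X]addrC.
Qed.

End concentration.

(** * Matrices acting on tuples *)

Section tmul.
Context {R : realType}.

Definition tmul {m d} (A : 'M[R]_(m, d)) (t : d.-tuple R) : m.-tuple R :=
  [tuple \sum_(j < d) A i j * tnth t j | i < m].

Lemma colv_tmul m d (A : 'M[R]_(m, d)) t : colv (tmul A t) = A *m colv t.
Proof.
by apply/colP => i; rewrite !mxE tnth_mktuple; apply: eq_bigr => j _; rewrite mxE.
Qed.

Context {m d : nat}.
Implicit Types (A : 'M[R]_(m, d)) (t u : d.-tuple R) (g : m.-tuple R).

Lemma tdot_colv n (t u : n.-tuple R) : tdot t u = ((colv t)^T *m colv u) 0 0.
Proof. by rewrite mxE; apply: eq_bigr => i _; rewrite !mxE. Qed.

Lemma bilin_tdot A g t : bilin A (colv g) (colv t) = tdot g (tmul A t).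
Proof. by rewrite /bilin tdot_colv colv_tmul mulmxA. Qed.

Lemma tdot_tmul A g t : tdot g (tmul A t) = tdot (tmul A^T g) t.
Proof. by rewrite !tdot_colv !colv_tmul trmx_mul trmxK mulmxA. Qed.

Lemma l2norm_colv n (t : n.-tuple R) : l2norm (colv t) = Num.sqrt (tdot t t).
Proof. by congr Num.sqrt; apply: eq_bigr => i _; rewrite mxE expr2. Qed.

Lemma colv_tuple n (x : 'cV[R]_n) : x = colv [tuple x i 0 | i < n].
Proof. by apply/colP => i; rewrite mxE tnth_mktuple. Qed.

(** The direction of A^T g; when A^T g = 0 the inverse of 0 makes x the zero
    vector, which is also correct. *)
Lemma tmul_norming A g : exists2 x, tdot x x <= 1 &
  tdot g (tmul A x) = Num.sqrt (tdot (tmul A^T g) (tmul A^T g)).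
Proof.
set u := tmul A^T g; set v := Num.sqrt _.
have v2 : v ^+ 2 = tdot u u by rewrite sqr_sqrtr// tdot_ge0.
pose x := tlin v^-1 0 u u.
have ux : tdot u x = v.
  rewrite tdotC tdot_scalel -v2 expr2 mulrA.
  by have [->|vN0] := eqVneq v 0; rewrite ?mulr0// mulVf// mul1r.
exists x; last by rewrite tdot_tmul.
rewrite tdot_scalel ux.
by have [->|vN0] := eqVneq v 0; rewrite ?mulr0// mulVf.
Qed.

Lemma tmul_lin A a b t u : tmul A (tlin a b t u) = tlin a b (tmul A t) (tmul A u).
Proof.
apply: eq_from_tnth => i; rewrite tnth_tlin !tnth_mktuple !mulr_sumr -big_split/=.
by apply: eq_bigr => j _; rewrite tnth_tlin; ring.
Qed.

Lemma tdot_tlin_le n (t u : n.-tuple R) a b :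
  tdot (tlin a b t u) (tlin a b t u) <= 2 * (a ^+ 2 * tdot t t + b ^+ 2 * tdot u u).
Proof.
rewrite /tdot !mulr_sumr -big_split/= mulr_sumr; apply: ler_sum => i _.
rewrite tnth_tlin; set x := tnth t i; set y := tnth u i.
have := sqr_ge0 (a * x - b * y); nra.
Qed.

Lemma measurable_tmul A disp (T : measurableType disp) (f : T -> d.-tuple R) :
  measurable_fun [set: T] f -> measurable_fun [set: T] (fun z => tmul A (f z)).
Proof.
move=> /measurable_fun_tnthP mf; apply/measurable_fun_tnthP => i.
rewrite (_ : _ \o _ = fun z => \sum_(j < d) A i j * tnth (f z) j).
  by apply: measurable_sum => j; apply: measurable_funM => //; exact: mf.
by apply/funext => z /=; rewrite tnth_mktuple.
Qed.

Lemma gaussian_tmul_second_moment A :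
  (\int[gaussian d]_t (tdot (tmul A t) (tmul A t))%:E <= (16 * hsnorm A ^+ 2)%:E)%E.
Proof.
pose a i : d.-tuple R := [tuple A i j | j < d].
have aE t : tdot (tmul A t) (tmul A t) = \sum_(i < m) tdot (a i) t ^+ 2.
  apply: eq_bigr => i _; rewrite tnth_mktuple -expr2; congr (_ ^+ 2).
  by apply: eq_bigr => j _; rewrite tnth_mktuple.
have ma i : measurable_fun [set: d.-tuple R] (fun t => (tdot (a i) t ^+ 2)%:E).
  apply/measurable_EFinP/measurable_funX.
  by apply: measurable_tdot; [exact: measurable_cst|exact: measurable_id].
have -> : hsnorm A ^+ 2 = \sum_(i < m) tdot (a i) (a i).
  rewrite sqr_sqrtr; last by apply: sumr_ge0 => i _; apply: sumr_ge0 => j _; rewrite sqr_ge0.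
  by apply: eq_bigr => i _; apply: eq_bigr => j _; rewrite tnth_mktuple expr2.
rewrite (eq_integral (fun t => \sum_(i < m) (tdot (a i) t ^+ 2)%:E)%E); last first.
  by move=> t _; rewrite aE sumEFin.
rewrite ge0_integral_sum; last 3 first.
- exact: measurableT.
- exact: ma.
- by move=> i t _; rewrite lee_fin sqr_ge0.
rewrite mulr_sumr -sumEFin; apply: lee_sum => i _.
exact: gaussian_second_moment.
Qed.

End tmul.

(** * From exponential moments to means *)

Section exponential_jensen.
Local Open Scope ereal_scope.
Context {R : realType} {n : nat}.

(** Integrate lam X <= a - 1 + exp (lam X - a). The condition 1 <= a keeps the
    constant a - 1 nonnegative, so that the sum can be integrated term by term. *)
Lemma integral_le_exp (X : n.-tuple R -> R) (lam a : R) :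
  (0 <= lam)%R -> (1 <= a)%R -> (forall t, 0 <= X t)%R ->
  measurable_fun [set: n.-tuple R] X ->
  \int[gaussian n]_t (expR (lam * X t))%:E <= (expR a)%:E ->
  lam%:E * \int[gaussian n]_t (X t)%:E <= a%:E.
Proof.
move=> lam0 a1 X0 mX Xa.
have mX' : measurable_fun [set: n.-tuple R] (fun t => (X t)%:E) by exact/measurable_EFinP.
have mE : measurable_fun [set: n.-tuple R] (fun t => (expR (lam * X t))%:E).
  by apply/measurable_EFinP; apply: measurableT_comp => //; exact: measurable_funM.
have e0 t : 0 <= (expR (lam * X t))%:E by rewrite lee_fin expR_ge0.
rewrite -integral_gaussianZl//.
apply: (@le_trans _ _ (\int[gaussian n]_t
    ((a - 1)%:E + (expR (- a))%:E * (expR (lam * X t))%:E))).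
  apply: le_integral_gaussian.
  - by move=> t; rewrite -EFinM lee_fin mulr_ge0.
  - exact: measurable_funeM.
  - by apply: emeasurable_funD; [exact: measurable_cst|exact: measurable_funeM].
  - move=> t; rewrite -!EFinM -EFinD lee_fin -expRD.
    by have := expR_ge1Dx (- a + lam * X t); lra.
rewrite integral_gaussianD; last 4 first.
- by move=> t; rewrite lee_fin subr_ge0.
- by move=> t; rewrite -EFinM lee_fin mulr_ge0// expR_ge0.
- exact: measurable_cst.
- exact: measurable_funeM.
rewrite integral_gaussian_cst integral_gaussianZl ?expR_ge0//.
apply: (@le_trans _ _ ((a - 1)%:E + (expR (- a))%:E * (expR a)%:E)).
  by apply: leeD2l => //; apply: lee_wpmul2l => //; rewrite lee_fin expR_ge0.
by rewrite -EFinM -expRD addNr expR0 -EFinD lee_fin; lra.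
Qed.

End exponential_jensen.

(** * The bound at a fixed smoothing level *)

Section smoothing.
Context {R : realType} {m d : nat}.
Variables (l : seq 'M[R]_(m, d)) (D H B S sigma : R).
Implicit Types (A : 'M[R]_(m, d)) (g : m.-tuple R) (t u h x : d.-tuple R).

Definition supbil g t : R := bigmax0 l (fun A => `|tdot g (tmul A t)|).

(** Called N in the overview above: a seminorm of t, bounded by B on the unit ball
    and of Gaussian mean S. *)
Definition meanbil t : \bar R := (\int[gaussian m]_g (supbil g t)%:E)%E.

Hypothesis opD : forall A x, A \in l -> tdot x x <= 1 ->
  tdot (tmul A x) (tmul A x) <= D ^+ 2.
Hypothesis hsH : forall A, A \in l -> hsnorm A <= H.
Hypothesis meanB : forall x, tdot x x <= 1 -> (meanbil x <= B%:E)%E.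
Hypothesis meanS : (\int[gaussian d]_t meanbil t <= S%:E)%E.
Hypotheses (D0 : 0 < D) (H0 : 0 < H) (S0 : 0 < S).
Hypotheses (sigma0 : 0 < sigma) (sigma1 : sigma <= 1).

Lemma supbil_ge0 g t : 0 <= supbil g t. Proof. exact: bigmax0_ge0. Qed.

Lemma measurable_supbil disp (T : measurableType disp) (a : T -> m.-tuple R) (b : T -> d.-tuple R) :
  measurable_fun [set: T] a -> measurable_fun [set: T] b ->
  measurable_fun [set: T] (fun z => supbil (a z) (b z)).
Proof.
move=> ma mb; apply: (measurable_bigmax0 _ _ l (fun A z => `|tdot (a z) (tmul A (b z))|)) => A.
apply: measurableT_comp => //; apply: measurable_tdot; first exact: ma.
exact: measurable_tmul.
Qed.

Lemma meanbil_ge0 t : (0 <= meanbil t)%E.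
Proof. by apply: integral_ge0 => g _; rewrite lee_fin supbil_ge0. Qed.

Lemma measurable_meanbil : measurable_fun [set: d.-tuple R] meanbil.
Proof.
apply: measurable_integral_gaussian => [|t g]; last by rewrite lee_fin supbil_ge0.
apply/measurable_EFinP; apply: measurable_supbil; first exact: measurable_snd.
exact: measurable_fst.
Qed.

Lemma supbil_lin g a b t u : supbil g (tlin a b t u) <= `|a| * supbil g t + `|b| * supbil g u.
Proof.
apply: bigmax0_le; first by rewrite addr_ge0// mulr_ge0// supbil_ge0.
move=> A Al; rewrite tmul_lin tdotC tdot_linl (le_trans (ler_normD _ _))// !normrM.
by apply: lerD; rewrite ler_wpM2l// tdotC; exact: (le_bigmax0 l (fun A => `|tdot g (tmul A _)|)).
Qed.

Lemma meanbil_lin a b t u :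
  (meanbil (tlin a b t u) <= `|a|%:E * meanbil t + `|b|%:E * meanbil u)%E.
Proof.
have ms v : measurable_fun [set: m.-tuple R] (fun g => (supbil g v)%:E).
  by apply/measurable_EFinP; apply: measurable_supbil; [exact: measurable_id|exact: measurable_cst].
have s0 v g : (0 <= (supbil g v)%:E)%E by rewrite lee_fin supbil_ge0.
rewrite /meanbil -!integral_gaussianZl//.
rewrite -integral_gaussianD; last 4 first.
- by move=> g; rewrite -EFinM lee_fin mulr_ge0// supbil_ge0.
- by move=> g; rewrite -EFinM lee_fin mulr_ge0// supbil_ge0.
- by apply: measurable_funeM; exact: ms.
- by apply: measurable_funeM; exact: ms.
apply: le_integral_gaussian.
- exact: s0.
- exact: ms.
- by apply: emeasurable_funD; apply: measurable_funeM; exact: ms.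
- by move=> g; rewrite -!EFinM -EFinD lee_fin supbil_lin.
Qed.

(** The factor 2 pays for |a + b| ^ 2 <= 2 |a| ^ 2 + 2 |b| ^ 2, used with
    a = A x and b = sigma A h. *)
Let K : R := 2 * (D + 8 * sigma * H).
Let K2 : R := B + 4 * sigma * S.

(** The points t at which the truncation keeps the matrix A. The condition on
    meanbil does not involve A: where it fails, every matrix is discarded. *)
Definition admissible A : set (d.-tuple R) :=
  [set t | ((tdot (tmul A t) (tmul A t))%:E <= (K ^+ 2)%:E)%E] `&`
  [set t | (meanbil t <= K2%:E)%E].

Lemma measurable_sublevel (f : d.-tuple R -> \bar R) y :
  measurable_fun [set: d.-tuple R] f -> measurable [set t | (f t <= y)%E].
Proof.
by move=> mf; rewrite -[X in measurable X]setTI; exact: emeasurable_fun_infty_c.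
Qed.

Lemma measurable_sqnorm_tmul A :
  measurable_fun [set: d.-tuple R] (fun t => (tdot (tmul A t) (tmul A t))%:E).
Proof.
apply/measurable_EFinP.
by apply: measurable_tdot; apply: measurable_tmul; exact: measurable_id.
Qed.

Lemma measurable_admissible A : measurable (admissible A).
Proof.
apply: measurableI; apply: measurable_sublevel; first exact: measurable_sqnorm_tmul.
exact: measurable_meanbil.
Qed.

Let trunc A t : m.-tuple R := tlin (\1_(admissible A) t) 0 (tmul A t) (tmul A t).

Definition truncsup g t : R := bigmax0 l (fun A => `|tdot g (trunc A t)|).

Lemma truncsup_ge0 g t : 0 <= truncsup g t. Proof. exact: bigmax0_ge0. Qed.

Let tdot_trunc g A t : tdot g (trunc A t) = \1_(admissible A) t * tdot g (tmul A t).
Proof. by rewrite tdotC tdot_scalel tdotC. Qed.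

Lemma le_truncsup g A t : A \in l -> admissible A t ->
  `|tdot g (tmul A t)| <= truncsup g t.
Proof.
move=> Al At; apply: le_trans (le_bigmax0 l (fun A => `|tdot g (trunc A t)|) _ Al).
by rewrite tdot_trunc indicE mem_set// mul1r.
Qed.

Lemma measurable_truncsup disp (T : measurableType disp) (a : T -> m.-tuple R)
    (b : T -> d.-tuple R) :
  measurable_fun [set: T] a -> measurable_fun [set: T] b ->
  measurable_fun [set: T] (fun z => truncsup (a z) (b z)).
Proof.
move=> ma mb.
apply: (measurable_bigmax0 _ _ l (fun A z => `|tdot (a z) (trunc A (b z))|)) => A.
apply: measurableT_comp => //.
rewrite [X in measurable_fun _ X](_ : _ = fun z => \1_(admissible A) (b z) *
    tdot (a z) (tmul A (b z))); last by apply/funext => z; rewrite tdot_trunc.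
apply: measurable_funM; last by apply: measurable_tdot; [exact: ma|exact: measurable_tmul].
by apply: measurableT_comp mb; apply: measurable_indic; exact: measurable_admissible.
Qed.

Local Open Scope ereal_scope.

Let K2_ge0 : (0 <= K2)%R.
Proof.
have B0 : (0 <= B)%R.
  by rewrite -lee_fin (le_trans (meanbil_ge0 _) (meanB _ tdot_zero_le1)).
by rewrite addr_ge0// !mulr_ge0// ltW.
Qed.

(** Concentration applies with K as a bound for the vectors A t that are kept. The
    mean of truncsup is at most K2, either because it is at most meanbil t <= K2,
    or because everything is discarded. *)
Lemma truncsup_exp_moment lam t : (0 <= lam)%R ->
  \int[gaussian m]_g (expR (lam * truncsup g t))%:E <=
  (2 * expR (lam * K2 + 2 * lam ^+ 2 * K ^+ 2))%:E.
Proof.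
move=> lam0; pose l' := [seq trunc A t | A <- l].
have E g : truncsup g t = maxdot l' g by rewrite /truncsup /maxdot /bigmax0 big_map.
under eq_integral do rewrite E.
apply: maxdot_concentration => //.
  move=> a /mapP[A Al ->]; rewrite tdot_trunc tdotC tdot_trunc indicE.
  case: (boolP (t \in admissible A)) => [|_]; last by rewrite !mul0r sqr_ge0.
  by rewrite inE => -[/= + _]; rewrite lee_fin !mul1r.
under eq_integral do rewrite -E.
have [tK2|/negP tK2] := boolP (meanbil t <= K2%:E); last first.
  rewrite integral0_eq ?lee_fin// => g _; congr EFin.
  rewrite /truncsup; have [->//|[A Al ->]] := bigmax0_attained l (fun A => `|tdot g (trunc A t)|%R).
  rewrite tdot_trunc indicE memNset ?mul0r ?normr0// => -[_ /=]; exact: tK2.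
apply: le_trans tK2; apply: le_integral_gaussian.
- by move=> g; rewrite lee_fin truncsup_ge0.
- by apply/measurable_EFinP; apply: measurable_truncsup; [exact: measurable_id|exact: measurable_cst].
- by apply/measurable_EFinP; apply: measurable_supbil; [exact: measurable_id|exact: measurable_cst].
- move=> g; rewrite lee_fin; apply: bigmax0_le => [|A Al]; first exact: supbil_ge0.
  rewrite tdot_trunc normrM (le_trans _ (le_bigmax0 l (fun A => `|tdot g (tmul A t)|%R) _ Al))//.
  by rewrite ler_piMl// indicE; case: (_ \in _); rewrite ?normr1 ?normr0.
Qed.

(** The shifts h for which A is kept at sigma h +- x and the Cameron-Martin
    density is at least weight. The set is invariant under x |-> - x. *)
Definition typical A x : set (d.-tuple R) :=
  [set h | (tdot (tmul A h) (tmul A h))%:E <= (64 * H ^+ 2)%:E] `&`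
  ([set h | (tdot x h ^+ 2)%:E <= 64%:E] `&` [set h | meanbil h <= (4 * S)%:E]).

Lemma measurable_typical A x : measurable (typical A x).
Proof.
apply: measurableI; first by apply: measurable_sublevel; exact: measurable_sqnorm_tmul.
apply: measurableI; apply: measurable_sublevel; last exact: measurable_meanbil.
apply/measurable_EFinP/measurable_funX.
by apply: measurable_tdot; [exact: measurable_cst|exact: measurable_id].
Qed.

(** Markov's inequality for three nonnegative functions of mean at most 1 / 4 after
    normalization: the sum of the three and of the indicator is at least 1. The
    thresholds 64 H ^ 2, 64 and 4 S are four times the bounds on the means. *)
Lemma typical_ge A x : A \in l -> (tdot x x <= 1)%R ->
  (1 / 4)%:E <= \int[gaussian d]_h (\1_(typical A x) h)%:E.
Proof.
move=> Al x1.
pose f1 h := ((64 * H ^+ 2)^-1)%:E * (tdot (tmul A h) (tmul A h))%:E.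
pose f2 h := (64^-1)%:E * (tdot x h ^+ 2)%:E.
pose f3 h := ((4 * S)^-1)%:E * meanbil h.
have m1 : measurable_fun [set: d.-tuple R] f1.
  by apply: measurable_funeM; exact: measurable_sqnorm_tmul.
have mx : measurable_fun [set: d.-tuple R] (fun h => (tdot x h ^+ 2)%:E).
  apply/measurable_EFinP/measurable_funX.
  by apply: measurable_tdot; [exact: measurable_cst|exact: measurable_id].
have m2 : measurable_fun [set: d.-tuple R] f2 by exact: measurable_funeM.
have m3 : measurable_fun [set: d.-tuple R] f3.
  by apply: measurable_funeM; exact: measurable_meanbil.
have mI : measurable_fun [set: d.-tuple R] (fun h => (\1_(typical A x) h)%:E : \bar R).
  by apply/measurable_EFinP/measurable_indic; exact: measurable_typical.
have H2 : (0 < 64 * H ^+ 2)%R by rewrite mulr_gt0// exprn_gt0.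
have S4 : (0 < 4 * S)%R by rewrite mulr_gt0.
have f10 h : 0 <= f1 h by rewrite /f1 -EFinM lee_fin mulr_ge0 ?tdot_ge0// invr_ge0 ltW.
have f20 h : 0 <= f2 h by rewrite /f2 -EFinM lee_fin mulr_ge0 ?sqr_ge0// invr_ge0.
have f30 h : 0 <= f3 h by rewrite /f3 mule_ge0 ?meanbil_ge0// lee_fin invr_ge0 ltW.
have I0 h : 0 <= (\1_(typical A x) h : R)%:E by rewrite lee_fin.
have pw h : 1%:E <= (\1_(typical A x) h)%:E + (f1 h + (f2 h + f3 h)).
  have f23 : 0 <= f2 h + f3 h by rewrite adde_ge0.
  have f123 : 0 <= f1 h + (f2 h + f3 h) by rewrite adde_ge0.
  have [hE|hE] := pselect (typical A x h).
    by rewrite indicE mem_set// leeDl.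
  rewrite indicE memNset// add0e.
  have scale (k y : R) : (0 < k)%R -> (k < y)%R -> (1 <= k^-1 * y)%R.
    by move=> k0 ky; rewrite mulrC ler_pdivlMr// mul1r ltW.
  have [h1|/negP] := boolP ((tdot (tmul A h) (tmul A h))%:E <= (64 * H ^+ 2)%:E); last first.
    rewrite lee_fin => /negP; rewrite -ltNge => h1.
    apply: le_trans (leeDl _ f23); rewrite /f1 -EFinM lee_fin; exact: scale.
  apply: le_trans (leeDr _ (f10 h)).
  have [h2|/negP] := boolP ((tdot x h ^+ 2)%:E <= 64%:E); last first.
    rewrite lee_fin => /negP; rewrite -ltNge => h2.
    by apply: le_trans (leeDl _ (f30 h)); rewrite /f2 -EFinM lee_fin; exact: scale.
  apply: le_trans (leeDr _ (f20 h)).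
  have [h3|/negP] := boolP (meanbil h <= (4 * S)%:E); first by exfalso; apply: hE.
  move=> /negP; rewrite -ltNge => h3.
  have k0 : 0 <= ((4 * S)^-1)%:E by rewrite lee_fin invr_ge0 ltW.
  apply: le_trans (lee_wpmul2l k0 (ltW h3)).
  by rewrite -EFinM mulVf// gt_eqF.
have int1 : 1%:E <= \int[gaussian d]_h (\1_(typical A x) h)%:E +
    (\int[gaussian d]_h f1 h + (\int[gaussian d]_h f2 h + \int[gaussian d]_h f3 h)).
  rewrite -(integral_gaussianD _ _ f20 f30 m2 m3).
  have f230 h : 0 <= f2 h + f3 h by rewrite adde_ge0.
  have m23 : measurable_fun [set: d.-tuple R] (fun h => f2 h + f3 h).
    exact: emeasurable_funD.
  rewrite -(integral_gaussianD _ _ f10 f230 m1 m23).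
  have f1230 h : 0 <= f1 h + (f2 h + f3 h) by rewrite adde_ge0.
  have m123 : measurable_fun [set: d.-tuple R] (fun h => f1 h + (f2 h + f3 h)).
    exact: emeasurable_funD.
  rewrite -(integral_gaussianD _ _ I0 f1230 mI m123).
  rewrite -[leLHS](integral_gaussian_cst (n := d)); apply: le_integral_gaussian.
  - by move=> h; rewrite lee_fin.
  - exact: measurable_cst.
  - exact: emeasurable_funD.
  - exact: pw.
have b1 : \int[gaussian d]_h f1 h <= (1 / 4)%:E.
  rewrite integral_gaussianZl; last 3 first.
  - by rewrite invr_ge0 ltW.
  - by move=> h; rewrite lee_fin tdot_ge0.
  - exact: measurable_sqnorm_tmul.
  apply: (@le_trans _ _ (((64 * H ^+ 2)^-1)%:E * (16 * H ^+ 2)%:E)).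
    apply: lee_wpmul2l; first by rewrite lee_fin invr_ge0 ltW.
    apply: le_trans (gaussian_tmul_second_moment A) _.
    rewrite lee_fin ler_wpM2l// lerXn2r ?nnegrE ?sqrtr_ge0 ?(ltW H0)//.
    exact: hsH.
  rewrite -EFinM lee_fin (_ : _ * _ = 1 / 4)%R//.
  by field; rewrite gt_eqF.
have b2 : \int[gaussian d]_h f2 h <= (1 / 4)%:E.
  rewrite integral_gaussianZl; last 3 first.
  - by rewrite invr_ge0.
  - by move=> h; rewrite lee_fin sqr_ge0.
  - exact: mx.
  apply: (@le_trans _ _ ((64^-1)%:E * 16%:E)).
    apply: lee_wpmul2l; first by rewrite lee_fin invr_ge0.
    apply: le_trans (gaussian_second_moment x) _.
    by rewrite lee_fin; lra.
  rewrite -EFinM lee_fin (_ : _ * _ = 1 / 4)%R//.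
  by field.
have b3 : \int[gaussian d]_h f3 h <= (1 / 4)%:E.
  rewrite integral_gaussianZl; last 3 first.
  - by rewrite invr_ge0 ltW.
  - exact: meanbil_ge0.
  - exact: measurable_meanbil.
  apply: (@le_trans _ _ (((4 * S)^-1)%:E * S%:E)).
    by apply: lee_wpmul2l meanS; rewrite lee_fin invr_ge0 ltW.
  rewrite -EFinM lee_fin (_ : _ * _ = 1 / 4)%R//.
  by field; rewrite gt_eqF.
have b123 : \int[gaussian d]_h f1 h + (\int[gaussian d]_h f2 h + \int[gaussian d]_h f3 h)
    <= (3 / 4)%:E.
  apply: (le_trans (leeD b1 (leeD b2 b3))).
  by rewrite -!EFinD lee_fin; lra.
have I00 : 0 <= \int[gaussian d]_h (\1_(typical A x) h : R)%:E.
  by apply: integral_ge0 => h _; exact: I0.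
move: I00 (le_trans int1 (leeD2l _ b123)).
case: (\int[gaussian d]_h (\1_(typical A x) h)%:E) => [r _|_ _|//]; last exact: leey.
by rewrite -EFinD !lee_fin; lra.
Qed.

(** A lower bound for the Cameron-Martin factor of the shift x / sigma at the h
    with |x . h| <= 8. *)
Let weight : R := expR (- (8 / sigma) - 1 / (2 * sigma ^+ 2)).

(** Cameron-Martin with shift x / sigma, keeping only h in E. *)
Lemma shift_lower (f : d.-tuple R -> \bar R) x :
  (tdot x x <= 1)%R -> measurable_fun [set: d.-tuple R] f -> (forall t, 0 <= f t) ->
  forall E, measurable E -> (forall h, E h -> (tdot x h ^+ 2 <= 64)%R) ->
  \int[gaussian d]_h (weight%:E * ((\1_E h)%:E * f (tlin sigma 1 h x))) <=
  \int[gaussian d]_h f (tlin sigma 0 h h).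
Proof.
move=> x1 mf f0 E mE Ex.
have sN0 : (sigma != 0)%R by rewrite gt_eqF.
pose y := tlin sigma^-1 0 x x.
have yE h : tdot y h = (sigma^-1 * tdot x h)%R by rewrite tdot_scalel.
have yy : tdot y y = (sigma^-1 ^+ 2 * tdot x x)%R by rewrite yE tdotC yE mulrA.
have mfs : measurable_fun [set: d.-tuple R] (fun h => f (tlin sigma 0 h h)).
  by apply: (measurableT_comp mf); apply: measurable_tlin; exact: measurable_id.
have mfs1 : measurable_fun [set: d.-tuple R] (fun h => f (tlin sigma 1 h x)).
  apply: (measurableT_comp mf).
  by apply: measurable_tlin; [exact: measurable_id|exact: measurable_cst].
rewrite [leRHS](cameron_martin d y _ mfs (fun h => f0 _)).
have shift h : tlin sigma 0 (tlin 1 1 h y) (tlin 1 1 h y) = tlin sigma 1 h x.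
  by apply: eq_from_tnth => i; rewrite !tnth_tlin; field.
apply: le_integral_gaussian.
- by move=> h; rewrite mule_ge0 ?lee_fin ?expR_ge0// mule_ge0// lee_fin.
- apply: measurable_funeM; apply: emeasurable_funM => //.
  by apply/measurable_EFinP/measurable_indic.
- under eq_fun do rewrite shift; apply: emeasurable_funM => //.
  apply/measurable_EFinP/measurableT_comp => //; apply: measurable_funB => //.
  apply: measurableT_comp => //.
  by apply: measurable_tdot; [exact: measurable_cst|exact: measurable_id].
move=> h; rewrite shift.
have [hE|hE] := pselect (E h); last first.
  rewrite indicE memNset// mul0e mule0 mule_ge0// lee_fin; exact: expR_ge0.
rewrite indicE mem_set// mul1e muleC; apply: lee_wpmul2l => //.
rewrite lee_fin ler_expR yE yy.
have xh : (tdot x h <= 8)%R by have := Ex _ hE; set v := tdot x h; nra.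
have i0 : (0 < sigma^-1)%R by rewrite invr_gt0.
have -> : (8 / sigma = sigma^-1 * 8)%R by rewrite mulrC.
have -> : (1 / (2 * sigma ^+ 2) = sigma^-1 ^+ 2 / 2)%R by field.
have := ler_wpM2l (ltW i0) xh.
have := sqr_ge0 sigma^-1; nra.
Qed.

(** For h in the typical set both sigma h + x and sigma h - x see A, and one of
    the numbers |<g, A (sigma h +- x)>| is at least |<g, A x>|. *)
Lemma tilted_lower_bound (lam : R) g A x : (0 <= lam)%R -> A \in l -> (tdot x x <= 1)%R ->
  (expR (lam * `|tdot g (tmul A x)|))%:E <=
  (8 * weight^-1)%:E * \int[gaussian d]_h (expR (lam * truncsup g (tlin sigma 0 h h)))%:E.
Proof.
move=> lam0 Al x1.
pose f t := (expR (lam * truncsup g t))%:E.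
have f0 t : 0 <= f t by rewrite lee_fin expR_ge0.
have mf : measurable_fun [set: d.-tuple R] f.
  apply/measurable_EFinP/measurableT_comp => //; apply: measurable_funM => //.
  by apply: measurable_truncsup; [exact: measurable_cst|exact: measurable_id].
pose E := typical A x.
have mE : measurable E by exact: measurable_typical.
have Ex h : E h -> (tdot x h ^+ 2 <= 64)%R by move=> -[_ [/=]]; rewrite lee_fin.
pose x' := tlin (-1) 0 x x.
have x'E h : tdot x' h = (- tdot x h)%R by rewrite tdot_scalel mulN1r.
have x'1 : (tdot x' x' <= 1)%R by rewrite x'E tdotC x'E opprK.
have Ex' h : E h -> (tdot x' h ^+ 2 <= 64)%R by rewrite x'E sqrrN; exact: Ex.
have adm y h : (tdot y y <= 1)%R -> E h -> admissible A (tlin sigma 1 h y).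
  move=> y1 [/= hH [_ /= hN]]; split => /=.
    rewrite lee_fin tmul_lin (le_trans (tdot_tlin_le _ _ _ _ _))// /K.
    rewrite lee_fin in hH; have AyD := opD _ _ Al y1.
    have h1 := ler_wpM2l (sqr_ge0 sigma) hH.
    have : (0 <= D * (sigma * H))%R by rewrite !mulr_ge0// ltW.
    have := sqr_ge0 (sigma * H); have := sqr_ge0 D.
    move: h1 AyD; set p := tdot _ _; set q := tdot _ _; nra.
  apply: (le_trans (meanbil_lin _ _ _ _)).
  rewrite normr1 mul1e gtr0_norm// /K2 [X in _ <= X%:E]addrC EFinD.
  apply: leeD; last exact: meanB.
  rewrite (_ : 4 * sigma * S = sigma * (4 * S))%R; last by ring.
  by rewrite EFinM; apply: lee_wpmul2l => //; rewrite lee_fin ltW.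
have L1 := shift_lower f x x1 mf f0 E mE Ex.
have L2 := shift_lower f x' x'1 mf f0 E mE Ex'.
set I := \int[gaussian d]_h _.
have w0 : (0 < weight)%R by exact: expR_gt0.
have key : (weight * expR (lam * `|tdot g (tmul A x)|))%:E *
    \int[gaussian d]_h (\1_E h)%:E <= I + I.
  apply: le_trans (leeD L1 L2).
  have mI : measurable_fun [set: d.-tuple R] (fun h => (\1_E h)%:E : \bar R).
    by apply/measurable_EFinP/measurable_indic.
  have mfy y : measurable_fun [set: d.-tuple R] (fun h => f (tlin sigma 1 h y)).
    apply: (measurableT_comp mf).
    by apply: measurable_tlin; [exact: measurable_id|exact: measurable_cst].
  have mT y : measurable_fun [set: d.-tuple R]
      (fun h => weight%:E * ((\1_E h)%:E * f (tlin sigma 1 h y))).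
    by apply: measurable_funeM; exact: emeasurable_funM.
  have T0 y h : 0 <= weight%:E * ((\1_E h)%:E * f (tlin sigma 1 h y)).
    by rewrite mule_ge0 ?lee_fin ?expR_ge0// mule_ge0// lee_fin.
  rewrite -(integral_gaussianD _ _ (T0 x) (T0 x') (mT x) (mT x')).
  rewrite -integral_gaussianZl; last 3 first.
  - by rewrite mulr_ge0// expR_ge0.
  - by move=> h; rewrite lee_fin.
  - exact: mI.
  apply: le_integral_gaussian.
  - by move=> h; rewrite -EFinM lee_fin !mulr_ge0// expR_ge0.
  - exact: measurable_funeM.
  - exact: emeasurable_funD.
  move=> h; have [hE|hE] := pselect (E h); last by rewrite indicE memNset// !mul0e !mule0 adde0.
  rewrite indicE mem_set// !mul1e mule1 -!EFinM -EFinD lee_fin -mulrDr ler_wpM2l ?expR_ge0//.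
  have F1 := le_truncsup g _ _ Al (adm _ _ x1 hE).
  have F2 := le_truncsup g _ _ Al (adm _ _ x'1 hE).
  move: F1 F2; rewrite !tmul_lin.
  set p := tdot g (tmul A x); pose q := tdot g (tmul A h).
  have -> : tdot g (tlin sigma 1 (tmul A h) (tmul A x)) = (sigma * q + p)%R.
    by rewrite tdotC tdot_linl mul1r !(tdotC _ g).
  have -> : tdot g (tlin sigma 1 (tmul A h) (tlin (-1) 0 (tmul A x) (tmul A x))) = (sigma * q - p)%R.
    by rewrite tdotC tdot_linl mul1r tdot_scalel mulN1r !(tdotC _ g).
  rewrite /f; set F1 := truncsup _ _; set F2 := truncsup _ _ => pF1 pF2.
  have p12 : (`|p| <= F1 \/ `|p| <= F2)%R.
    have tri : (2 * `|p| <= `|sigma * q + p| + `|sigma * q - p|)%R.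
      have e : ((sigma * q + p) - (sigma * q - p) = 2 * p)%R by ring.
      have := ler_normB (sigma * q + p)%R (sigma * q - p)%R; rewrite e normrM ger0_norm//.
    have [h1|h1] := leP `|p|%R F1; [by left|right; lra].
  case: p12 => hp.
    have : (expR (lam * `|p|) <= expR (lam * F1))%R by rewrite ler_expR ler_wpM2l.
    have := expR_ge0 (lam * F2); lra.
  have : (expR (lam * `|p|) <= expR (lam * F2))%R by rewrite ler_expR ler_wpM2l.
  have := expR_ge0 (lam * F1); lra.
have I0 : 0 <= I by apply: integral_ge0 => h _; rewrite lee_fin expR_ge0.
have w4 : 0 <= (4 * weight^-1)%:E by rewrite lee_fin mulr_ge0// invr_ge0 ltW.
have -> : (8 * weight^-1)%:E * I = (4 * weight^-1)%:E * (I + I).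
  have k0 : (0 < 4 * weight^-1)%R by rewrite mulr_gt0// invr_gt0.
  rewrite (_ : 8 * weight^-1 = 2 * (4 * weight^-1))%R; last by ring.
  case: I I0 {key} => [r _|_|//].
    by rewrite -EFinD -!EFinM; congr EFin; ring.
  have k20 : (0 < 2 * (4 * weight^-1))%R by rewrite mulr_gt0.
  by rewrite gt0_muley ?lte_fin//; apply/esym/gt0_muley; rewrite lte_fin.
apply: le_trans (lee_wpmul2l w4 key).
have we0 : 0 <= (weight * expR (lam * `|tdot g (tmul A x)|))%:E.
  by rewrite lee_fin mulr_ge0// expR_ge0.
apply: le_trans (lee_wpmul2l w4 (lee_wpmul2l we0 (typical_ge A x Al x1))).
rewrite -!EFinM lee_fin.
suff -> : (4 / weight * (weight * expR (lam * `|tdot g (tmul A x)|) * (1 / 4)) =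
  expR (lam * `|tdot g (tmul A x)|))%R by [].
by field; rewrite gt_eqF.
Qed.

Definition supnorm g : R := bigmax0 l (fun A => Num.sqrt (tdot (tmul A^T g) (tmul A^T g))).

Lemma supnorm_ge0 g : (0 <= supnorm g)%R. Proof. exact: bigmax0_ge0. Qed.

Lemma measurable_supnorm : measurable_fun [set: m.-tuple R] supnorm.
Proof.
apply: (measurable_bigmax0 _ _ l (fun A g => Num.sqrt (tdot (tmul A^T g) (tmul A^T g)))) => A.
apply: measurableT_comp; first by apply: continuous_measurable_fun; exact: sqrt_continuous.
by apply: measurable_tdot; apply: measurable_tmul; exact: measurable_id.
Qed.

Let weight_le1 : (weight <= 1)%R.
Proof.
rewrite -expR0 ler_expR subr_le0 (@le_trans _ _ 0%R)//.
  by rewrite oppr_le0 divr_ge0// ltW.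
by rewrite divr_ge0// mulr_ge0// sqr_ge0.
Qed.

Lemma exp_supnorm_le (lam : R) g : (0 <= lam)%R ->
  (expR (lam * supnorm g))%:E <=
  (8 * weight^-1)%:E * \int[gaussian d]_h (expR (lam * truncsup g (tlin sigma 0 h h)))%:E.
Proof.
move=> lam0.
have w0 : (0 < weight)%R by exact: expR_gt0.
rewrite /supnorm.
have [->|[A Al ->]] := bigmax0_attained l (fun A => Num.sqrt (tdot (tmul A^T g) (tmul A^T g))).
  rewrite mulr0 expR0.
  apply: (@le_trans _ _ ((8 * weight^-1)%:E * 1%:E)).
    rewrite mule1 lee_fin -[X in (X <= _)%R]mul1r ler_pM//; first by lra.
    by rewrite -[leLHS]invr1 lef_pV2 ?posrE.
  apply: lee_wpmul2l; first by rewrite lee_fin mulr_ge0// invr_ge0 ltW.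
  rewrite -[leLHS](integral_gaussian_cst (n := d)); apply: le_integral_gaussian.
  - by move=> h; rewrite lee_fin.
  - exact: measurable_cst.
  - apply/measurable_EFinP/measurableT_comp => //; apply: measurable_funM => //.
    apply: measurable_truncsup; first exact: measurable_cst.
    by apply: measurable_tlin; exact: measurable_id.
  - by move=> h; rewrite lee_fin -expR0 ler_expR mulr_ge0// truncsup_ge0.
have [x x1 gAx] := tmul_norming A g.
have := tilted_lower_bound lam g A x lam0 Al x1.
by rewrite gAx ger0_norm// sqrtr_ge0.
Qed.

(** With lam = 1 / (sigma K) the terms 1 / sigma ^ 2 of the density and
    lam ^ 2 K ^ 2 of the concentration are of the same order; dividing the
    exponent by lam leaves K2 + 15 K / sigma. *)
Lemma supnorm_bound :
  \int[gaussian m]_g (supnorm g)%:E <= (B + 4 * sigma * S + 30 * D / sigma + 240 * H)%:E.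
Proof.
have sN0 : (sigma != 0)%R by rewrite gt_eqF.
have K0 : (0 < K)%R by rewrite mulr_gt0// addr_gt0// !mulr_gt0.
have KN0 : (K != 0)%R by rewrite gt_eqF.
pose lam : R := (sigma * K)^-1%R.
have lam0 : (0 < lam)%R by rewrite invr_gt0 mulr_gt0.
have lK : (lam * K = sigma^-1)%R by rewrite /lam invfM -mulrA mulVf// mulr1.
have w0 : (0 < weight)%R by exact: expR_gt0.
pose a : R := (15 * sigma^-1 ^+ 2 + lam * K2)%R.
have s1 : (1 <= sigma^-1)%R by rewrite -[leLHS]invr1 lef_pV2 ?posrE.
have a1 : (1 <= a)%R.
  have : (0 <= lam * K2)%R by rewrite mulr_ge0// ltW.
  rewrite /a; nra.
have w8 : (0 <= 8 * weight^-1)%R by rewrite mulr_ge0// invr_ge0 ltW.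
have mM : measurable_fun [set: m.-tuple R * d.-tuple R]
    (fun z => (expR (lam * truncsup z.1 (tlin sigma 0 z.2 z.2)))%:E).
  apply/measurable_EFinP/measurableT_comp => //; apply: measurable_funM => //.
  apply: measurable_truncsup; first exact: measurable_fst.
  by apply: measurable_tlin; exact: measurable_snd.
have M0 g h : 0 <= (expR (lam * truncsup g (tlin sigma 0 h h)))%:E by rewrite lee_fin expR_ge0.
have mIM : measurable_fun [set: m.-tuple R]
    (fun g => \int[gaussian d]_h (expR (lam * truncsup g (tlin sigma 0 h h)))%:E).
  by apply: measurable_integral_gaussian; [exact: mM|exact: M0].
have main : \int[gaussian m]_g (expR (lam * supnorm g))%:E <= (expR a)%:E.
  apply: (@le_trans _ _ (\int[gaussian m]_g ((8 * weight^-1)%:E *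
      \int[gaussian d]_h (expR (lam * truncsup g (tlin sigma 0 h h)))%:E))).
    apply: le_integral_gaussian.
    - by move=> g; rewrite lee_fin expR_ge0.
    - apply/measurable_EFinP/measurableT_comp => //; apply: measurable_funM => //.
      exact: measurable_supnorm.
    - by apply: measurable_funeM; exact: mIM.
    - by move=> g; apply: exp_supnorm_le; exact: ltW.
  rewrite integral_gaussianZl; last 3 first.
  - exact: w8.
  - by move=> g; apply: integral_ge0 => h _; exact: M0.
  - exact: mIM.
  rewrite (integral_gaussian_swap _ _ _ mM M0).
  pose c := (2 * expR (lam * K2 + 2 * lam ^+ 2 * K ^+ 2))%R.
  apply: (@le_trans _ _ ((8 * weight^-1)%:E * c%:E)).
    apply: lee_wpmul2l; first by rewrite lee_fin.
    rewrite -[leRHS](integral_gaussian_cst (n := d)); apply: le_integral_gaussian.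
    - by move=> h; apply: integral_ge0 => g _; exact: M0.
    - apply: measurable_integral_gaussian => [|h g]; last exact: M0.
      apply/measurable_EFinP/measurableT_comp => //; apply: measurable_funM => //.
      apply: measurable_truncsup; first exact: measurable_snd.
      by apply: measurable_tlin; exact: measurable_fst.
    - exact: measurable_cst.
    - by move=> h; apply: truncsup_exp_moment; exact: ltW.
  rewrite -EFinM lee_fin /c /weight -expRN.
  rewrite mulrACA -expRD.
  have e4 : (8 * 2 <= expR 4 :> R)%R.
    have e1 := expR_ge1Dx (1 : R).
    rewrite -[X in expR X]mulr1 expRM_natl.
    have -> : (8 * 2 = 2 ^+ 4 :> R)%R by ring.
    by rewrite lerXn2r ?nnegrE ?expR_ge0//; lra.
  apply: (le_trans (ler_wpM2r (expR_ge0 _) e4)).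
  rewrite -expRD ler_expR.
  have -> : (2 * lam ^+ 2 * K ^+ 2 = 2 * sigma^-1 ^+ 2)%R by rewrite -lK; ring.
  have -> : (1 / (2 * sigma ^+ 2) = sigma^-1 ^+ 2 / 2)%R by field.
  rewrite /a; move: s1; set r := sigma^-1%R; nra.
have := integral_le_exp supnorm lam a (ltW lam0) a1 supnorm_ge0 measurable_supnorm main.
have sK : 0 <= (sigma * K)%:E by rewrite lee_fin mulr_ge0// ltW.
move=> /(lee_wpmul2l sK).
have e : (sigma * K * lam = 1)%R by rewrite /lam mulfV// mulf_neq0.
rewrite muleA -!EFinM e mul1e => /le_trans; apply.
rewrite lee_fin /a mulrDr (mulrA _ lam) e mul1r mulrA.
rewrite (_ : sigma * K * 15 * sigma^-1 ^+ 2 = 30 * D / sigma + 240 * H)%R; last by rewrite /K; field.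
by rewrite /K2; lra.
Qed.

End smoothing.

(** * Operator and Hilbert-Schmidt norms *)

Section norms.
Context {R : realType} {m d : nat}.
Implicit Types (A : 'M[R]_(m, d)) (x : d.-tuple R).

Lemma tmul_le_hsnorm A x : tdot x x <= 1 -> tdot (tmul A x) (tmul A x) <= hsnorm A ^+ 2.
Proof.
move=> x1; rewrite sqr_sqrtr; last first.
  by apply: sumr_ge0 => i _; apply: sumr_ge0 => j _; rewrite sqr_ge0.
apply: ler_sum => i _; rewrite -expr2 tnth_mktuple.
pose a : d.-tuple R := [tuple A i j | j < d].
have -> : \sum_j A i j * tnth x j = tdot a x.
  by apply: eq_bigr => j _; rewrite tnth_mktuple.
have -> : \sum_j A i j ^+ 2 = tdot a a.
  by apply: eq_bigr => j _; rewrite tnth_mktuple expr2.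
by rewrite (le_trans (tdot_cauchy_schwarz _ _))// ler_piMr// tdot_ge0.
Qed.

Lemma colv_unit (y : 'cV[R]_d) : l2norm y <= 1 ->
  exists2 x, y = colv x & tdot x x <= 1.
Proof.
rewrite (colv_tuple _ y) l2norm_colv; set x := mktuple _ => x1; exists x => //.
by rewrite -[leRHS](expr1n _ 2) -(sqr_sqrtr (tdot_ge0 x)) lerXn2r ?nnegrE ?sqrtr_ge0.
Qed.

Lemma unit_colv x : tdot x x <= 1 -> l2norm (colv x) <= 1.
Proof. by move=> x1; rewrite l2norm_colv -sqrtr1 ler_wsqrtr. Qed.

Lemma l2norm_ge0 n (x : 'cV[R]_n) : 0 <= l2norm x. Proof. exact: sqrtr_ge0. Qed.

Lemma hsnorm_ge0 A : 0 <= hsnorm A. Proof. exact: sqrtr_ge0. Qed.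

Let image_le_hs A (y : R) :
  [set l2norm (A *m x) | x in [set x : 'cV[R]_d | l2norm x <= 1]] y -> y <= hsnorm A.
Proof.
move=> [z /= /colv_unit[x -> x1] <-].
rewrite -colv_tmul l2norm_colv -[leRHS]ger0_norm ?hsnorm_ge0// -sqrtr_sqr.
by rewrite ler_wsqrtr// tmul_le_hsnorm.
Qed.

Lemma opnorm_le_hsnorm A : opnorm A <= hsnorm A.
Proof.
apply: sup_le_ub => [|y]; last exact: image_le_hs.
exists (l2norm (A *m 0)); exists 0 => //=.
by rewrite /l2norm big1 ?sqrtr0// => i _; rewrite mxE expr0n.
Qed.

Lemma l2norm_le_opnorm A (x : 'cV[R]_d) : l2norm x <= 1 -> l2norm (A *m x) <= opnorm A.
Proof.
move=> x1; apply: ub_le_sup; last by exists x.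
by exists (hsnorm A) => y; exact: image_le_hs.
Qed.

Lemma opnorm_ge0 A : 0 <= opnorm A.
Proof.
apply: le_trans (l2norm_le_opnorm A 0 _); first exact: l2norm_ge0.
by rewrite /l2norm big1 ?sqrtr0// => i _; rewrite mxE expr0n.
Qed.

Lemma tmul_le_opnorm A x : tdot x x <= 1 -> tdot (tmul A x) (tmul A x) <= opnorm A ^+ 2.
Proof.
move=> x1; rewrite -(sqr_sqrtr (tdot_ge0 (tmul A x))) lerXn2r ?nnegrE ?sqrtr_ge0 ?opnorm_ge0//.
by rewrite -l2norm_colv colv_tmul; apply: l2norm_le_opnorm; exact: unit_colv.
Qed.

End norms.

Lemma sup_bigmax0 (R : realType) (I : eqType) (l : seq I) (f : I -> R) :
  [set` l] !=set0 -> (forall i, 0 <= f i) ->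
  sup [set f i | i in [set` l]] = bigmax0 l f.
Proof.
move=> [i0 i0l] f0; apply/eqP; rewrite eq_le; apply/andP; split.
  apply: sup_le_ub; first by exists (f i0); exists i0.
  by move=> _ [i il <-]; exact: le_bigmax0.
have ub i : i \in l -> f i <= sup [set f i | i in [set` l]].
  move=> il; apply: ub_le_sup; last by exists i.
  by exists (bigmax0 l f) => _ [j jl <-]; exact: le_bigmax0.
by apply: bigmax0_le => //; rewrite (le_trans (f0 i0))// ub.
Qed.

(** * Optimization of the smoothing level *)

Section core.
Local Open Scope ereal_scope.
Context {R : realType} {m d : nat}.
Variables (l : seq 'M[R]_(m, d)) (D H : R) (B : \bar R).
Hypothesis opD : forall A x, A \in l -> (tdot x x <= 1)%R ->
  (tdot (tmul A x) (tmul A x) <= D ^+ 2)%R.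
Hypothesis hsH : forall A, A \in l -> (hsnorm A <= H)%R.
Hypotheses (D0 : (0 <= D)%R) (DH : (D <= H)%R) (B0 : 0 <= B).
Hypothesis meanB : forall x, (tdot x x <= 1)%R -> meanbil l x <= B.

Let W : \bar R := \int[gaussian m]_g (supnorm l g)%:E.
Let S : \bar R := \int[gaussian d]_t meanbil l t.

Lemma supnorm_eq0 g : D = 0%R -> supnorm l g = 0%R.
Proof.
move=> D_eq0; apply/eqP; rewrite eq_le supnorm_ge0 andbT.
apply: bigmax0_le => // A Al; have [x x1 <-] := tmul_norming A g.
have := opD _ _ Al x1; rewrite D_eq0 expr0n => Ax0.
by rewrite tdotC tdot_eq0//; apply/eqP; rewrite eq_le Ax0 tdot_ge0.
Qed.

(** If S <= D, take sigma = 1 and use D <= H. Otherwise sigma = sqrt (D / S) makes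
    both sigma S and D / sigma equal to sqrt (D S). *)
Lemma width_bound : W <= 300%:E * (H%:E + B + sqrte (D%:E * S)).
Proof.
have H0 : (0 <= H)%R by exact: le_trans DH.
have S0 : 0 <= S by apply: integral_ge0 => t _; exact: meanbil_ge0.
have HB0 : 0 <= H%:E + B by rewrite adde_ge0.
have [D_eq0|DN0] := eqVneq D 0%R.
  rewrite /W integral0_eq; last by move=> g _; rewrite supnorm_eq0.
  by apply: mule_ge0; [rewrite lee_fin ler0n|rewrite adde_ge0// sqrte_ge0].
have {DN0} Dgt0 : (0 < D)%R by rewrite lt_neqAle eq_sym DN0.
have Hgt0 : (0 < H)%R by exact: lt_le_trans DH.
have top : W <= 300%:E * +oo by rewrite gt0_muley ?leey ?lte_fin ?ltr0n.
move: B0 meanB HB0; case: B => [b| |//] b0 meanb HB0; last first.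
  by rewrite addey// addye// -?ltNye ?(lt_le_trans _ (sqrte_ge0 _)).
rewrite lee_fin in b0.
case SE : S S0 => [s| |//] S0; last first.
  by rewrite (gt0_muley (x := D%:E)) ?lte_fin//= addey.
rewrite lee_fin in S0.
have meanS : \int[gaussian d]_t meanbil l t <= s%:E by rewrite -/S SE.
rewrite -EFinM/=.
have [sD|Ds] := leP s D.
  have meanSD : \int[gaussian d]_t meanbil l t <= D%:E by rewrite (le_trans meanS).
  have := supnorm_bound l D H b D 1 opD hsH meanb meanSD Dgt0 Hgt0 Dgt0 ltr01 (lexx _).
  move=> /le_trans; apply; rewrite lee_fin.
  have q0 : (0 <= Num.sqrt (D * s) :> R)%R by exact: sqrtr_ge0.
  by rewrite divr1; move: q0 DH H0 b0; set q : R := Num.sqrt _; lra.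
have sgt0 : (0 < s)%R by exact: lt_trans Ds.
pose q := Num.sqrt (D * s).
have q0 : (0 < q)%R by rewrite sqrtr_gt0 mulr_gt0.
have q2 : (q ^+ 2 = D * s)%R by rewrite sqr_sqrtr// mulr_ge0// ltW.
pose sigma := (q / s)%R.
have sigma0 : (0 < sigma)%R by rewrite divr_gt0.
have sigma1 : (sigma <= 1)%R.
  by rewrite ler_pdivrMr// mul1r; nra.
have := supnorm_bound l D H b s sigma opD hsH meanb meanS Dgt0 Hgt0 sgt0 sigma0 sigma1.
move=> /le_trans; apply; rewrite lee_fin -/q.
have -> : (4 * sigma * s = 4 * q)%R by rewrite /sigma; field; rewrite gt_eqF.
have -> : (30 * D / sigma = 30 * q)%R.
  have -> : (D = q ^+ 2 / s)%R by rewrite q2; field; rewrite gt_eqF.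
  by rewrite /sigma; field; rewrite !gt_eqF.
lra.
Qed.

Lemma sqrte_AMGM (p : R) : (1 <= p)%R -> 0 <= S ->
  sqrte (D%:E * S) <= S * ((Num.sqrt p)^-1)%:E + (Num.sqrt p)%:E * D%:E.
Proof.
move=> p1; have q0 : (0 < Num.sqrt p)%R by rewrite sqrtr_gt0; lra.
case: S => [s| |//] S0; last first.
  by rewrite gt0_mulye ?lte_fin ?invr_gt0// addye// leey.
rewrite lee_fin in S0.
rewrite -!EFinM -EFinD lee_fin; set q := Num.sqrt p in q0 *.
have h0 : (0 <= s * q^-1 + q * D)%R.
  by rewrite addr_ge0// mulr_ge0// ?invr_ge0 ltW.
rewrite -[leRHS]ger0_norm// -sqrtr_sqr ler_wsqrtr//.
have -> : (D * s = (s * q^-1) * (q * D))%R by field; rewrite gt_eqF.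
have := mulr_ge0 S0 (ltW (_ : 0 < q^-1)%R); rewrite invr_gt0 => /(_ q0).
have := mulr_ge0 (ltW q0) D0.
set x := (s * q^-1)%R; set y := (q * D)%R; nra.
Qed.

End core.

(** * The parameters of the family as integrals over the Gaussian measures *)

Section parameters_of_list.
Local Open Scope ereal_scope.
Context {R : realType} {m d : nat} (l : seq 'M[R]_(m, d)).
Context {disp : measure_display} {T : measurableType disp}.
Variables (P : probability T R).
Variables (g : {RV P >-> m.-tuple R}) (h : {RV P >-> d.-tuple R}).
Hypothesis l0 : [set` l] !=set0.
Hypotheses (sg : standard_gaussian g) (sh : standard_gaussian h).
Hypothesis gh : independent_vectors g h.

Lemma sup_bilin (x : d.-tuple R) (y : m.-tuple R) :
  sup [set `|bilin A (colv y) (colv x)|%R | A in [set` l]] = supbil l y x.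
Proof.
rewrite sup_bigmax0//; congr bigmax0.
by apply/funext => A; rewrite bilin_tdot.
Qed.

Lemma Wparam_list : Wparam [set` l] g = \int[gaussian m]_y (supnorm l y)%:E.
Proof.
rewrite /Wparam unlock -(integral_standard_gaussian P m g); first last.
- by move=> t; rewrite lee_fin supnorm_ge0.
- by apply/measurable_EFinP; exact: measurable_supnorm.
- exact: sg.
apply: eq_integral => w _; congr EFin; rewrite sup_bigmax0//; last first.
  by move=> A; exact: l2norm_ge0.
by congr bigmax0; apply/funext => A; rewrite -colv_tmul l2norm_colv.
Qed.

Lemma Sparam_list : Sparam [set` l] g h = \int[gaussian d]_t meanbil l t.
Proof.
have ms : measurable_fun [set: m.-tuple R * d.-tuple R] (fun z => (supbil l z.1 z.2)%:E).
  apply/measurable_EFinP.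
  by apply: measurable_supbil; [exact: measurable_fst|exact: measurable_snd].
have s0 y x : 0 <= (supbil l y x)%:E by rewrite lee_fin supbil_ge0.
rewrite /Sparam unlock /meanbil -(integral_gaussian_swap m d _ ms s0).
rewrite -(integral_standard_gaussian2 P m d g h _ sg sh gh ms s0).
by apply: eq_integral => w _; congr EFin; exact: sup_bilin.
Qed.

Lemma meanbil_le_Bparam (x : d.-tuple R) : (tdot x x <= 1)%R ->
  meanbil l x <= Bparam [set` l] g.
Proof.
move=> x1; apply: ereal_sup_ubound; exists (colv x); first exact: unit_colv.
rewrite unlock /meanbil -(integral_standard_gaussian P m g); first last.
- by move=> t; rewrite lee_fin supbil_ge0.
- apply/measurable_EFinP.
  by apply: measurable_supbil; [exact: measurable_id|exact: measurable_cst].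
- exact: sg.
by apply: eq_integral => w _; congr EFin; exact: sup_bilin.
Qed.

Lemma hsnorm_le_Hparam A : A \in l -> (hsnorm A <= Hparam [set` l])%R.
Proof.
move=> Al; rewrite /Hparam sup_bigmax0//; last by move=> B; exact: hsnorm_ge0.
exact: le_bigmax0.
Qed.

Lemma DparamE : Dparam [set` l] = bigmax0 l (@opnorm R m d).
Proof. by rewrite /Dparam sup_bigmax0// => B; exact: opnorm_ge0. Qed.

Lemma tmul_le_Dparam A (x : d.-tuple R) : A \in l -> (tdot x x <= 1)%R ->
  (tdot (tmul A x) (tmul A x) <= Dparam [set` l] ^+ 2)%R.
Proof.
move=> Al x1; apply: (le_trans (tmul_le_opnorm A x x1)).
have AD : (opnorm A <= Dparam [set` l])%R by rewrite DparamE; exact: le_bigmax0.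
by rewrite lerXn2r ?nnegrE ?(le_trans (opnorm_ge0 A))// opnorm_ge0.
Qed.

Lemma Dparam_ge0 : (0 <= Dparam [set` l])%R.
Proof. by rewrite DparamE bigmax0_ge0. Qed.

Lemma Dparam_le_Hparam : (Dparam [set` l] <= Hparam [set` l])%R.
Proof.
have [A0 A0l] := l0; rewrite DparamE; apply: bigmax0_le => [|A Al].
  by rewrite (le_trans (hsnorm_ge0 A0))// hsnorm_le_Hparam.
by rewrite (le_trans (opnorm_le_hsnorm A))// hsnorm_le_Hparam.
Qed.

Lemma Bparam_ge0 : 0 <= Bparam [set` l] g.
Proof.
exact: le_trans (meanbil_ge0 l _) (meanbil_le_Bparam _ tdot_zero_le1).
Qed.

End parameters_of_list.

(** * The comparison theorem *)

Theorem theorem1p1 (R : realType) :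
  exists C : R, 0 < C /\
  forall (m d : nat) (AA : set 'M[R]_(m, d)),
    (0 < m)%N -> (0 < d)%N -> finite_set AA -> AA !=set0 ->
  forall (disp : measure_display) (T : measurableType disp)
    (P : probability T R)
    (g : {RV P >-> m.-tuple R}) (h : {RV P >-> d.-tuple R}),
    standard_gaussian g -> standard_gaussian h -> independent_vectors g h ->
  let W := Wparam AA g in
  let S := Sparam AA g h in
  let B := Bparam AA g in
  let H := (Hparam AA)%:E in
  let D := (Dparam AA)%:E in
  (W <= C%:E * (H + B + sqrte (D * S)))%E /\
  forall p : R, 1 <= p ->
    (W <= C%:E * (S * ((Num.sqrt p)^-1)%:E + B + H + (Num.sqrt p)%:E * D))%E.
Proof.
exists 300; split; first by rewrite ltr0n.
move=> m d AA _ _ /finite_seqP[l ->] l0 disp T P g h sg sh gh W S B H D.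
have main : (W <= 300%:E * (H + B + sqrte (D * S)))%E.
  rewrite /W /S /H /D /B (Wparam_list l P g l0 sg) (Sparam_list l P g h l0 sg sh gh).
  apply: width_bound.
  - by move=> A x; exact: tmul_le_Dparam.
  - by move=> A; exact: hsnorm_le_Hparam.
  - exact: Dparam_ge0.
  - exact: Dparam_le_Hparam.
  - exact: Bparam_ge0.
  - by move=> x; exact: meanbil_le_Bparam.
split=> // p p1; apply: (le_trans main).
apply: lee_wpmul2l; first by rewrite lee_fin ler0n.
have -> : (S * ((Num.sqrt p)^-1)%:E + B + H + (Num.sqrt p)%:E * D =
    H + B + (S * ((Num.sqrt p)^-1)%:E + (Num.sqrt p)%:E * D))%E.
  by rewrite [RHS]addeA [in RHS](addeC (H + B)%E) [in RHS](addeC H B) [in RHS]addeA.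
apply: leeD2l => //; rewrite /S (Sparam_list l P g h l0 sg sh gh).
apply: sqrte_AMGM => //; first exact: Dparam_ge0.
by apply: integral_ge0 => t _; exact: meanbil_ge0.
Qed.
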